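(* Let $n \ge 2$. For $R>0$ let $B_R$ be the geodesic ball of radius $R$ in $\mathbb{H}^n$, and let $\lambda_i(B_R)$ be the $i$-th eigenvalue of the Laplace operator $-\Delta$ in $B_R$ with Dirichlet boundary conditions. Then there is a constant $C(n)$, depending only on $n$, such that for all $R>0$ $$\lambda_2(B_R) - \lambda_1(B_R) \le \frac{C(n)}{R^3}.$$ In particular, as $R \to \infty$, the quantity $(\lambda_2(B_R)-\lambda_1(B_R))\,R^2$ tends to $0$.
   Context: $\mathbb{H}^n$ is the $n$-dimensional hyperbolic space of constant sectional curvature $-1$. Eigenvalues are listed in increasing order, counted with multiplicity. *)

(* Defs.v *)
From mathcomp Require Import all_boot all_order all_algebra.
From mathcomp Require Import all_classical all_reals all_analysis.
Import Order.TTheory GRing.Theory Num.Theory numFieldNormedType.Exports.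
Set Implicit Arguments.
Unset Strict Implicit.
Unset Printing Implicit Defensive.
Local Open Scope classical_set_scope.
Local Open Scope ring_scope.

(** Riemannian metrics [g] on an open set [U] of R^n, in coordinates. *)

(* Every C^1 curve [0, 1] -> R^n extends to a C^1 curve R -> R^n, so asking for
   regularity on all of R avoids one-sided derivatives; only the values on
   [0, 1] have to lie in [U]. *)
Definition C1_path (R : realType) (n : nat) (U : set 'rV[R]_n)
    (x y : 'rV[R]_n) (c : R -> 'rV[R]_n) : Prop :=
  [/\ forall t, derivable c t 1, continuous (derive1 c),
      forall t, 0 <= t <= 1 -> U (c t), c 0 = x & c 1 = y].

Definition path_length (R : realType) (n : nat) (g : 'rV[R]_n -> 'M[R]_n)
    (c : R -> 'rV[R]_n) : R :=
  \int[lebesgue_measure]_(t in `[0, 1])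
    Num.sqrt ((derive1 c t *m g (c t) *m (derive1 c t)^T) 0 0).

Definition riemannian_dist (R : realType) (n : nat) (U : set 'rV[R]_n)
    (g : 'rV[R]_n -> 'M[R]_n) (x y : 'rV[R]_n) : R :=
  inf [set path_length g c | c in C1_path U x y].

Definition geodesic_ball (R : realType) (n : nat) (U : set 'rV[R]_n)
    (g : 'rV[R]_n -> 'M[R]_n) (o : 'rV[R]_n) (r : R) : set 'rV[R]_n :=
  [set x | U x /\ riemannian_dist U g o x < r].

(* (det g)^(-1/2) \sum_i d_i ((det g)^(1/2) \sum_j g^(ij) d_j f) *)
Definition laplace_beltrami (R : realType) (n : nat)
    (g : 'rV[R]_n -> 'M[R]_n) (f : 'rV[R]_n -> R) (x : 'rV[R]_n) : R :=
  (Num.sqrt (\det (g x)))^-1 *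
  \sum_(i < n) 'D_('e_i) (fun y => Num.sqrt (\det (g y)) *
    \sum_(j < n) (invmx (g y)) i j * 'D_('e_j) f y) x.

Definition C2_on (R : realType) (n : nat) (B : set 'rV[R]_n)
    (f : 'rV[R]_n -> R) : Prop :=
  forall x, B x ->
  [/\ {for x, continuous f},
      forall i, derivable f x 'e_i /\ {for x, continuous ('D_('e_i) f)} &
      forall i j, derivable ('D_('e_i) f) x 'e_j /\
                  {for x, continuous ('D_('e_j) ('D_('e_i) f))}].

(* Functions are total, but only their values on [closure B] matter. The zero
   function is not excluded here. *)
Definition dirichlet_eigenspace (R : realType) (n : nat)
    (g : 'rV[R]_n -> 'M[R]_n) (B : set 'rV[R]_n) (mu : R) :
    set ('rV[R]_n -> R) :=
  [set u | [/\ C2_on B u, {within closure B, continuous u},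
      forall x, B x -> - laplace_beltrami g u x = mu * u x &
      forall x, (closure B `\` B) x -> u x = 0]].

Definition lin_indep_on (R : realType) (T : Type) (B : set T) (k : nat)
    (u : 'I_k -> T -> R) : Prop :=
  forall a : 'I_k -> R,
    (forall x, B x -> \sum_(j < k) a j * u j x = 0) -> forall j, a j = 0.

(* There are at least [k] Dirichlet eigenvalues in ]-oo, t], counted with
   multiplicity. *)
Definition at_least_eigenvalues (R : realType) (n : nat)
    (g : 'rV[R]_n -> 'M[R]_n) (B : set 'rV[R]_n) (k : nat) (t : R) : Prop :=
  exists (mu : 'I_k -> R) (u : 'I_k -> 'rV[R]_n -> R),
    [/\ forall j, mu j <= t,
        forall j, dirichlet_eigenspace g B (mu j) (u j) &
        lin_indep_on B u].

(* The [k]-th entry, for [1 <= k], of the increasing list of the Dirichlet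
   eigenvalues counted with multiplicity. *)
Definition dirichlet_eigenvalue (R : realType) (n : nat)
    (g : 'rV[R]_n -> 'M[R]_n) (B : set 'rV[R]_n) (k : nat) : R :=
  inf [set t | at_least_eigenvalues g B k t].

(** Hyperbolic space of curvature -1: the Poincare model, i.e., the Euclidean
    unit ball with the metric 4 |dx|^2 / (1 - |x|^2)^2. The library norm on
    row vectors is the sup norm, hence the explicit Euclidean one. *)

Definition sqnorm (R : realType) (n : nat) (x : 'rV[R]_n) : R :=
  \sum_(i < n) x 0 i ^+ 2.

Definition hyp_space (R : realType) (n : nat) : set 'rV[R]_n :=
  [set x | sqnorm x < 1].

Definition hyp_metric (R : realType) (n : nat) (x : 'rV[R]_n) : 'M[R]_n :=
  (4 / (1 - sqnorm x) ^+ 2)%:M.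

(* The isometry group acts transitively, so the centre is immaterial. *)
Definition hyp_ball (R : realType) (n : nat) (r : R) : set 'rV[R]_n :=
  geodesic_ball (@hyp_space R n) (@hyp_metric R n) 0 r.

Definition hyp_eigenvalue (R : realType) (n : nat) (k : nat) (r : R) : R :=
  dirichlet_eigenvalue (@hyp_metric R n) (@hyp_ball R n r) k.

(* Main.v *)
Require Import Defs.
From mathcomp Require Import all_boot all_order all_algebra.
From mathcomp Require Import all_classical all_reals all_analysis.
From mathcomp Require Import ring lra.
Import Order.TTheory GRing.Theory Num.Theory numFieldNormedType.Exports.
Set Implicit Arguments.
Unset Strict Implicit.
Unset Printing Implicit Defensive.
Local Open Scope classical_set_scope.
Local Open Scope ring_scope.

(** Why the gap is O(r^-3).  In geodesic polar coordinates a function with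
    angular part of degree l solves, after multiplication by a power of sinh,
    y'' + (k^2 - V_l) y = 0 on the half line, where the eigenvalue is
    (n-1)^2/4 + k^2 and V_l is a constant multiple of 1/sinh^2.  As V_l decays
    exponentially, it only shifts the phase of sin(k rho) by O(k); the Dirichlet
    condition at rho = r therefore reads k (r + O(1)) = pi for l = 0 (the first
    eigenvalue) and for l = 1 (the second one), and both eigenvalues are
    (n-1)^2/4 + pi^2/r^2 + O(r^-3).  For bounded r both are O(r^-2).

    Neither eigenvalue has to be identified: a lower bound for the first one and
    an upper bound for the second one are enough.

    - The lower bound is Barta's ([barta_eigenvalue_ge]): a positive function psi
      on the closed ball with -Delta psi >= m psi forces every Dirichlet
      eigenvalue to be at least m, by the second derivative test at a maximum of
      |u|/psi.  Here psi = z^(-(n-1)/2) sin(k (ln z + 2n)) with z = cosh rho,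
      that is, a shifted logarithmic oscillation in z; it is smooth at the
      origin, and gives m = (n-1)^2/4 + pi^2/(r+2n)^2 ([barta_bound_long]).
      With psi = 1 the bound is 0.

    - For the upper bound it is enough to exhibit two independent eigenfunctions.
      In the Poincare model they are x_i H(s)/(1-s) with s = |x|^2: here
      x_i/(1-s) is half of the i-th coordinate of the hyperboloid model, and H
      has to be the regular radial solution in dimension n+2 for the eigenvalue
      mu = lambda + n, with a zero on the boundary of the ball
      ([coord_radial_eigenfunction], [regular_ode]).  H is a power series in s
      of radius at least 1 whose coefficients are Lipschitz in mu.  It decreases
      as long as it is nonnegative, so once some H_mu1 is nonpositive somewhere in
      the ball, the supremum of the mu with H_mu >= 0 is a parameter mu <= mu1 for
      which H_mu vanishes exactly on the boundary ([regular_zero_exists]).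

    - Such a mu1 comes from Sturm comparison ([regular_nonpos_of_subsolution])
      with an explicit subsolution.  The potential for l = 1 lies below
      2/sinh^2(rho - n), for which the equation has the elementary solutions
      coth t sin(k(t-c)) - k cos(k(t-c)), t = rho - n; this yields
      lambda <= (n-1)^2/4 + pi^2/(r-n-2)^2 ([regular_nonpos_long]).  For small r a
      sine on [r/2, r] suffices ([regular_nonpos_short]).

    The geodesic ball of radius r around the origin is the Euclidean ball of
    radius tanh(r/2) ([hyp_ballE]). *)

(** * Derivatives along a direction, computed pointwise *)

Section PointwiseDerivatives.
Context {R : realType} {V : normedModType R}.
Implicit Types (f g : V -> R) (x v : V) (a b : R).

(** A directional derivative is an ordinary derivative along a line; through
    this all the rules below reduce to one variable. *)
Lemma is_derive_lineE f x v (t a : R) :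
  is_derive (t *: v + x) v f a -> is_derive t 1 (fun h : R => f (h *: v + x)) a.
Proof.
move=> [df <-].
have E : (fun h : R => h^-1 *: (f (h *: v + (t *: v + x)) - f (t *: v + x))) =
   (fun h : R => h^-1 *: ((fun k : R => f (k *: v + x)) (h *: 1 + t)
      - (fun k : R => f (k *: v + x)) t)).
  by apply/funext => h /=; rewrite [h%:A]mulr1 scalerDl addrA.
by split; rewrite /derivable /derive -E.
Qed.

Lemma is_derive_line f x v a :
  is_derive (0 : R) 1 (fun h : R => f (h *: v + x)) a -> is_derive x v f a.
Proof.
move=> [df <-].
have E : (fun h : R => h^-1 *: (f (h *: v + x) - f x)) =
   (fun h : R => h^-1 *: ((fun k : R => f (k *: v + x)) (h *: 1 + 0)
      - (fun k : R => f (k *: v + x)) 0)).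
  by apply/funext => h /=; rewrite [h%:A]mulr1 addr0 scale0r add0r.
by split; rewrite /derivable /derive E.
Qed.

(** The rules are restated for functions given by pointwise formulas, the form
    in which a concrete expression can be differentiated by following its
    syntax. *)
Lemma is_derive_addf f g x v a b : is_derive x v f a -> is_derive x v g b ->
  is_derive x v (fun y => f y + g y) (a + b).
Proof. by move=> ? ?; exact: is_deriveD. Qed.

Lemma is_derive_oppf f x v a : is_derive x v f a -> is_derive x v (fun y => - f y) (- a).
Proof. by move=> ?; exact: is_deriveN. Qed.

Lemma is_derive_mulf f g x v a b : is_derive x v f a -> is_derive x v g b ->
  is_derive x v (fun y => f y * g y) (a * g x + f x * b).
Proof.
move=> ? ?; apply: (is_derive_eq (is_deriveM _ _)).
by rewrite addrC [a * _]mulrC.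
Qed.

Lemma is_derive_expf f x v a n : is_derive x v f a ->
  is_derive x v (fun y => f y ^+ n) (n%:R * f x ^+ n.-1 * a).
Proof.
move=> df; have -> : (fun y => f y ^+ n) = f ^+ n.
  by apply/funext => y; rewrite fctE.
case: n => [|n].
  rewrite !mul0r; have -> : f ^+ 0 = cst 1 by apply/funext => y; rewrite fctE expr0.
  exact: is_derive_cst.
apply: (is_derive_eq (is_deriveX _ _)).
by rewrite /= mulr_natl.
Qed.

Lemma is_derive_compf f (h : R -> R) x v a b : is_derive x v f a -> is_derive (f x) 1 h b ->
  is_derive x v (fun y => h (f y)) (b * a).
Proof.
move=> df dh; apply: is_derive_line.
have df0 : is_derive (0 *: v + x) v f a by rewrite scale0r add0r.
have := @is_derive1_comp R h (fun k : R => f (k *: v + x)) 0 b a.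
apply; last exact: is_derive_lineE.
by rewrite scale0r add0r.
Qed.

Lemma is_derive_invf f x v a : f x != 0 -> is_derive x v f a ->
  is_derive x v (fun y => (f y)^-1) (- a / f x ^+ 2).
Proof.
move=> fx df.
have dV : is_derive (f x) 1 (fun y : R => y^-1) (- (f x) ^- 2).
  apply: is_derive_eq (@is_deriveV R id (f x) 1 1 fx _) _.
  by rewrite scaler1.
by apply: (is_derive_eq (is_derive_compf df dV)); rewrite !mulNr mulrC.
Qed.

Lemma is_derive_val f x v a b : is_derive x v f a -> a = b -> is_derive x v f b.
Proof. by move=> ? <-. Qed.

End PointwiseDerivatives.

Lemma is_derive_sumf (R : realType) (V : normedModType R) n (f : 'I_n -> V -> R) x v
    (a : 'I_n -> R) : (forall i, is_derive x v (f i) (a i)) ->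
  is_derive x v (fun y => \sum_i f i y) (\sum_i a i).
Proof.
move=> df; have -> : (fun y => \sum_i f i y) = \sum_i f i.
  by apply/funext => y; rewrite fct_sumE.
exact: is_derive_sum.
Qed.

(** [is_derive] is a class, and the usual application tactics would look for
    an instance of each premise, settling the derivative in some other form;
    hence the untyped refinements. *)
Ltac differentiate_head := lazymatch goal with
  | |- is_derive _ _ (fun t => t) _ => notypeclasses refine (is_derive_id _ _)
  | |- is_derive _ _ (fun t => @?f t + @?g t) _ =>
      notypeclasses refine (@is_derive_addf _ _ f g _ _ _ _ _ _)
  | |- is_derive _ _ (fun t => - @?f t) _ =>
      notypeclasses refine (@is_derive_oppf _ _ f _ _ _ _)
  | |- is_derive _ _ (fun t => @?f t * @?g t) _ =>
      notypeclasses refine (@is_derive_mulf _ _ f g _ _ _ _ _ _)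
  | |- is_derive _ _ (fun t => (@?f t) ^+ ?n) _ =>
      notypeclasses refine (@is_derive_expf _ _ f _ _ _ n _)
  | |- is_derive _ _ (fun t => (@?f t) ^-1) _ =>
      notypeclasses refine (@is_derive_invf _ _ f _ _ _ _ _)
  | |- is_derive _ _ (fun t => sin (@?f t)) _ =>
      notypeclasses refine (@is_derive_compf _ _ f sin _ _ _ _ _ (is_derive_sin _))
  | |- is_derive _ _ (fun t => cos (@?f t)) _ =>
      notypeclasses refine (@is_derive_compf _ _ f cos _ _ _ _ _ (is_derive_cos _))
  | |- is_derive _ _ (fun t => expR (@?f t)) _ =>
      notypeclasses refine (@is_derive_compf _ _ f expR _ _ _ _ _ (is_derive_expR _))
  | |- is_derive _ _ (fun t => ln (@?f t)) _ =>
      notypeclasses refine (@is_derive_compf _ _ f (@ln _) _ _ _ _ _ (is_derive1_ln _))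
  end.
Ltac differentiate_rec := try (
  first [eassumption | notypeclasses refine (is_derive_cst _ _ _)
        | differentiate_head]; differentiate_rec).
Ltac differentiate := notypeclasses refine (is_derive_val _ _); [differentiate_rec|]; cbv beta.

Lemma is_derive_coord (R : realType) n (x v : 'rV[R]_n) i :
  is_derive x v (fun y : 'rV[R]_n => y 0 i) (v 0 i).
Proof.
apply: is_derive_line.
have -> : (fun h : R => (h *: v + x) 0 i) = (fun h => h * v 0 i + x 0 i).
  by apply/funext => h; rewrite !mxE.
differentiate.
by rewrite mul1r mulr0 !addr0.
Qed.

Lemma is_derive_continuous (R : realType) (f : R -> R) (x a : R) :
  is_derive x 1 f a -> {for x, continuous f}.
Proof.
by move=> df; apply/differentiable_continuous/derivable1_diffP; exact: ex_derive.
Qed.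

Section OneVariable.
Context {R : realType}.
Implicit Types f g : R -> R.

(** If the second derivative were positive, the first one, which vanishes at
    the maximum, would be positive just to the right of it, and the function
    would increase there. *)
Lemma local_max_test f f' (t0 d e : R) : 0 < e ->
  (forall t, `|t - t0| < e -> is_derive t 1 f (f' t)) ->
  is_derive t0 1 f' d ->
  (forall t, `|t - t0| < e -> f t <= f t0) -> f' t0 = 0 /\ d <= 0.
Proof.
move=> e0 df df' fmax.
have inE' t : t \in `]t0 - e, t0 + e[ -> `|t - t0| < e.
  by rewrite in_itv /= ltr_distl.
have f'0 : f' t0 = 0.
  have [] := @derive1_at_max R f (t0 - e) (t0 + e) t0.
  - by rewrite lerD2l; lra.
  - by move=> t /inE' te; have := df _ te => dft; exact: ex_derive.
  - by rewrite in_itv /=; apply/andP; split; lra.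
  - by move=> t /inE' te; exact: fmax.
  have dft : is_derive t0 1 f (f' t0) by apply: df; rewrite subrr normr0.
  by move=> _ <-; rewrite derive_val.
split=> //; rewrite leNgt; apply/negP => d0.
have [dd ddE] := df'.
move: dd; rewrite /derivable => /cvg_ex [l Hl].
have ld : l = d by rewrite -ddE; apply/esym/cvg_lim.
rewrite {}ld in Hl.
move/cvgrPdist_lt : Hl => /(_ d d0) [del /= del0 Hdel].
pose h := Num.min (e / 2) (del / 2).
have h0 : 0 < h by rewrite lt_min !divr_gt0.
have he : h < e by rewrite gt_min; apply/orP; left; lra.
have hd : h < del by rewrite gt_min; apply/orP; right; lra.
have pos y : t0 < y < t0 + h -> 0 < f' y.
  move=> /andP[y1 y2].
  have := Hdel (y - t0).
  have yd : ball_ Num.norm 0 del (y - t0).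
    by rewrite /ball_ /= sub0r normrN gtr0_norm ?subr_gt0//; lra.
  move=> /(_ yd); have -> : y - t0 != 0 by rewrite gt_eqF// subr_gt0.
  move=> /(_ isT); rewrite [(y - t0)%:A]mulr1 subrK f'0 subr0.
  rewrite /GRing.scale/= ltr_distl => /andP[_].
  rewrite ltrDr pmulr_rgt0// invr_gt0 subr_gt0//.
have [c cI fc] : exists2 c, c \in `]t0, t0 + h[ & f (t0 + h) - f t0 = f' c * h.
  have := @MVT R f f' t0 (t0 + h).
  rewrite [in t0 + h - t0]addrAC subrr add0r; apply.
  - by rewrite ltrDl.
  - move=> t; rewrite in_itv/= => /andP[t1 t2]; apply: df.
    by rewrite gtr0_norm ?subr_gt0//; lra.
  - apply: derivable_within_continuous => t; rewrite in_itv/= => /andP[t1 t2].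
    have dft : is_derive t 1 f (f' t).
      by apply: df; rewrite ger0_norm ?subr_ge0//; lra.
    exact: ex_derive.
have := fmax (t0 + h); rewrite [t0 + h - t0]addrAC subrr add0r gtr0_norm//.
move=> /(_ he); apply/negP; rewrite -ltNge -subr_gt0 fc mulr_gt0// pos//.
Qed.
End OneVariable.

(** * Hyperbolic balls around the origin are Euclidean balls *)

Definition dot (R : realType) n (a b : 'rV[R]_n) : R := \sum_i a 0 i * b 0 i.

(** The difference of the two sides is the squared norm of the component of a
    orthogonal to v. *)
Lemma dot_sqr_le (R : realType) n (a v : 'rV[R]_n) :
  sqnorm v = 1 -> dot a v ^+ 2 <= sqnorm a.
Proof.
move=> v1; rewrite -subr_ge0.
have -> : sqnorm a - dot a v ^+ 2 = \sum_i (a 0 i - dot a v * v 0 i) ^+ 2.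
  under eq_bigr => i _.
    have -> : (a 0 i - dot a v * v 0 i) ^+ 2 =
      a 0 i ^+ 2 + (dot a v ^+ 2 * v 0 i ^+ 2 - 2 * dot a v * (a 0 i * v 0 i)).
      by ring.
    over.
  rewrite big_split /= sumrB -!mulr_sumr -/(sqnorm a) -/(sqnorm v) -/(dot a v) v1.
  by ring.
by apply: sumr_ge0 => i _; rewrite sqr_ge0.
Qed.

Lemma sqnorm_ge0 (R : realType) n (a : 'rV[R]_n) : 0 <= sqnorm a.
Proof. by apply: sumr_ge0 => i _; rewrite sqr_ge0. Qed.

Lemma sqnormZ (R : realType) n (k : R) (a : 'rV[R]_n) :
  sqnorm (k *: a) = k ^+ 2 * sqnorm a.
Proof.
by rewrite /sqnorm mulr_sumr; apply: eq_bigr => i _; rewrite mxE exprMn.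
Qed.

Section UnitInterval.
Context {R : realType}.
Implicit Types f F : R -> R.

Lemma continuous_on01_integrable f : (forall t : R, 0 <= t <= 1 -> {for t, continuous f}) ->
  (@lebesgue_measure R).-integrable `[0, 1] (EFin \o f).
Proof.
move=> cf; apply: continuous_compact_integrable; first exact: segment_compact.
apply: continuous_in_subspaceT => t; rewrite inE /= in_itv /=; exact: cf.
Qed.

Lemma integral01 f F : (forall t : R, 0 <= t <= 1 -> is_derive t 1 F (f t)) ->
  (forall t : R, 0 <= t <= 1 -> {for t, continuous f}) ->
  \int[lebesgue_measure]_(t in `[0, 1]) f t = F 1 - F 0.
Proof.
move=> dF cf; rewrite /Rintegral (@continuous_FTC2 R f F) //.
- apply: continuous_in_subspaceT => t; rewrite inE /= in_itv /=; exact: cf.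
- split.
  + move=> t; rewrite in_itv /= => /andP[t0 t1].
    have := dF t; rewrite !ltW// => /(_ isT) ?; exact: ex_derive.
  + apply: cvg_at_right_filter; apply: (is_derive_continuous (dF 0 _)); rewrite lexx ler01//.
  + apply: cvg_at_left_filter; apply: (is_derive_continuous (dF 1 _)); rewrite lexx ler01//.
- move=> t; rewrite in_itv /= => /andP[t0 t1].
  have := dF t; rewrite !ltW// => /(_ isT) ?.
  by rewrite derive1E derive_val.
Qed.

End UnitInterval.

Section HyperbolicBall.
Context {R : realType}.

(** The hyperbolic distance from the origin to a point at Euclidean distance y
    from it. *)
Definition two_artanh (y : R) : R := ln (1 + y) - ln (1 - y).

Lemma is_derive_two_artanh (y : R) : -1 < y < 1 -> is_derive y 1 two_artanh (2 / (1 - y ^+ 2)).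
Proof.
move=> /andP[y0 y1]; rewrite /two_artanh; differentiate; [lra|lra|].
by field; rewrite !gt_eqF//; nra.
Qed.

Definition tanh_half (r : R) := (expR r - 1) / (expR r + 1).

Lemma tanh_half_lt1 r : tanh_half r < 1.
Proof.
rewrite /tanh_half ltr_pdivrMr; last by rewrite addr_gt0 ?expR_gt0.
by rewrite mul1r; lra.
Qed.

Lemma tanh_half_gt0 r : 0 < r -> 0 < tanh_half r.
Proof.
by rewrite -expR_gt1 => e1; apply: divr_gt0; lra.
Qed.

Lemma two_artanh_lt r y : -1 < y < 1 -> (two_artanh y < r) = (y < tanh_half r).
Proof.
move=> /andP[y0 y1]; rewrite /two_artanh -ln_div ?posrE; [|lra|lra].
have d0 : 0 < (1 + y) / (1 - y) by rewrite divr_gt0; lra.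
rewrite -[X in _ < X](expRK r) ltr_ln ?posrE ?expR_gt0//.
have E0 := expR_gt0 r.
rewrite ltr_pdivrMr; last by lra.
rewrite /tanh_half ltr_pdivlMr; last by lra.
by apply/idP/idP; nra.
Qed.

Lemma hyp_speed n (c v : 'rV[R]_n) : sqnorm c < 1 ->
  Num.sqrt ((v *m hyp_metric c *m v^T) 0 0) =
  2 / (1 - sqnorm c) * Num.sqrt (sqnorm v).
Proof.
move=> c1; rewrite /hyp_metric mul_mx_scalar -scalemxAl mxE.
have -> : (v *m v^T) 0 0 = sqnorm v.
  by rewrite mxE; apply: eq_bigr => i _; rewrite mxE expr2.
have -> : 4 / (1 - sqnorm c) ^+ 2 = (2 / (1 - sqnorm c)) ^+ 2.
  by field; rewrite subr_eq0 gt_eqF.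
rewrite sqrtrM ?sqr_ge0// sqrtr_sqr ger0_norm// divr_ge0// subr_ge0 ltW//.
Qed.

Section Paths.
Variable n : nat.
Implicit Types x v : 'rV[R]_n.

Lemma is_derive_path (c : R -> 'rV[R]_n) t i : derivable c t 1 ->
  is_derive t 1 (fun t => c t 0 i) (derive1 c t 0 i).
Proof.
move=> dc; rewrite derive1E derive_mx// mxE.
by apply/derivableP; move/derivable_mxP : dc; exact.
Qed.

Lemma continuous_coord (f : R -> 'rV[R]_n) t i : {for t, continuous f} ->
  {for t, continuous (fun t => f t 0 i)}.
Proof.
move=> cf; have cg := @coord_continuous R 1 n 0 i (f t).
exact: (continuous_comp cf cg).
Qed.

Lemma continuous_sum_at (T : topologicalType) (f : 'I_n -> T -> R) t :
  (forall i, {for t, continuous (f i)}) ->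
  {for t, continuous (fun t => \sum_i f i t)}.
Proof.
move=> cf; apply: (@cvg_big _ _ _ _ _ _ _ _ _ f (fun i => f i t)) => [|i _].
  exact: add_continuous.
exact: cf.
Qed.


Lemma is_derive_dot (c : R -> 'rV[R]_n) v t : derivable c t 1 ->
  is_derive t 1 (fun t => dot (c t) v) (dot (derive1 c t) v).
Proof.
move=> dc; apply: is_derive_sumf => i; differentiate; first exact: is_derive_path.
by rewrite mulr0 addr0.
Qed.

Lemma continuous_dot (f g : R -> 'rV[R]_n) (t : R) : {for t, continuous f} ->
  {for t, continuous g} -> {for t, continuous (fun t => dot (f t) (g t))}.
Proof.
move=> cf cg; apply: continuous_sum_at => i.
by apply: cvgM; exact: continuous_coord.
Qed.

Lemma sqnorm_dot x : sqnorm x = dot x x.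
Proof. by apply: eq_bigr => i _; rewrite expr2. Qed.

Definition hyp_speed_at (c : R -> 'rV[R]_n) t :=
  2 / (1 - sqnorm (c t)) * Num.sqrt (sqnorm (derive1 c t)).

Lemma path_length_hypE x y (c : R -> 'rV[R]_n) : C1_path (@hyp_space R n) x y c ->
  path_length (@hyp_metric R n) c =
  \int[lebesgue_measure]_(t in `[0, 1]) hyp_speed_at c t.
Proof.
move=> [_ _ Uc _ _]; apply: eq_Rintegral => t; rewrite inE /= in_itv /= => /Uc.
exact: hyp_speed.
Qed.

Lemma continuous_hyp_speed x y (c : R -> 'rV[R]_n) (t : R) :
  C1_path (@hyp_space R n) x y c ->
  0 <= t <= 1 -> {for t, continuous (hyp_speed_at c)}.
Proof.
move=> [dc cc Uc _ _] t01; have := Uc _ t01; rewrite /hyp_space /= => st.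
have cont : {for t, continuous c}.
  by apply/differentiable_continuous/derivable1_diffP.
apply: cvgM.
  apply: cvgM; first exact: cvg_cst.
  apply: cvgV; first by rewrite subr_eq0 gt_eqF.
  apply: cvgB; first exact: cvg_cst.
  have -> : (fun t => sqnorm (c t)) = (fun t => dot (c t) (c t)).
    by apply/funext => u; exact: sqnorm_dot.
  exact: continuous_dot.
have cq : {for t, continuous (fun t => sqnorm (derive1 c t))}.
  have -> : (fun t => sqnorm (derive1 c t)) =
            (fun t => dot (derive1 c t) (derive1 c t)).
    by apply/funext => u; exact: sqnorm_dot.
  by apply: continuous_dot; exact: cc.
exact: (continuous_comp cq (@sqrt_continuous _ _)).
Qed.

(** Along a radius the hyperbolic speed is the derivative of [two_artanh], so
    the straight path realizes the distance. *)
Lemma straight_path x : hyp_space x ->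
  C1_path (@hyp_space R n) 0 x (fun t => t *: x) /\
  path_length (@hyp_metric R n) (fun t => t *: x) = two_artanh (Num.sqrt (sqnorm x)).
Proof.
move=> Ux; have dc (t : R) i j :
    is_derive t 1 (fun t : R => (t *: x) i j) (x i j).
  have -> : (fun t : R => (t *: x) i j) = (fun t => t * x i j).
    by apply/funext => u; rewrite mxE.
  by differentiate; rewrite mul1r mulr0 addr0.
have dx (t : R) : derivable (fun t : R => t *: x) t 1.
  by apply/derivable_mxP => i j; have := dc t i j => ?; exact: ex_derive.
have d1x : derive1 (fun t : R => t *: x) = (fun=> x).
  apply/funext => t; rewrite derive1E derive_mx//; apply/matrixP => i j.
  by rewrite mxE; have := dc t i j => ?; rewrite derive_val.
have P : C1_path (@hyp_space R n) 0 x (fun t => t *: x).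
  split; [exact: dx | by rewrite d1x; exact: cst_continuous | |
          by rewrite scale0r | by rewrite scale1r].
  move=> t /andP[t0 t1]; rewrite /hyp_space /= sqnormZ.
  apply: le_lt_trans Ux; rewrite ler_piMl ?sqnorm_ge0//.
  by rewrite expr_le1.
split=> //; rewrite (path_length_hypE P).
set s := sqnorm x; set w := Num.sqrt s.
have w2 : w ^+ 2 = s by rewrite sqr_sqrtr// sqnorm_ge0.
have w0 : 0 <= w by rewrite sqrtr_ge0.
have w1 : w < 1 by rewrite -(@ltr_pXn2r _ 2)// ?nnegrE// w2 expr1n.
apply: (etrans (@integral01 _ _ (fun t => two_artanh (t * w)) _ _)).
- move=> t /andP[t0 t1].
  have tw : -1 < t * w < 1 by apply/andP; split; nra.
  have dt := @is_derive_compf R R (fun t => t * w) two_artanh t 1 _ _ _ (is_derive_two_artanh tw).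
  have dtw : is_derive t 1 (fun t => t * w) w by differentiate; rewrite mul1r mulr0 addr0.
  notypeclasses refine (is_derive_val (dt _ dtw) _).
  by rewrite /hyp_speed_at sqnormZ d1x -/s -/w -w2 exprMn.
- by move=> t; exact: continuous_hyp_speed P.
- by rewrite mul1r mul0r /two_artanh addr0 subr0 ln1 subr0 subr0.
Qed.

(** Projecting a path onto the line through its end point does not increase
    its hyperbolic length: the projection p of c satisfies |p'| <= |c'| and
    p^2 <= |c|^2. Unlike the Euclidean norm of c, this projection is
    differentiable at the origin as well. *)
Lemma path_length_ge x (c : R -> 'rV[R]_n) : hyp_space x ->
  C1_path (@hyp_space R n) 0 x c ->
  two_artanh (Num.sqrt (sqnorm x)) <= path_length (@hyp_metric R n) c.
Proof.
move=> Ux P; rewrite (path_length_hypE P).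
set s := sqnorm x; set w := Num.sqrt s.
have w2 : w ^+ 2 = s by rewrite sqr_sqrtr// sqnorm_ge0.
have [->|w0] := eqVneq w 0.
  rewrite /two_artanh addr0 subr0 subrr; apply: Rintegral_ge0 => t.
  rewrite /= in_itv /= => t01; case: P => _ _ /(_ _ t01) Uc _ _.
  by rewrite mulr_ge0 ?sqrtr_ge0// divr_ge0// subr_ge0 ltW.
(* the unit vector towards x, onto whose line the path is projected *)
pose v := w^-1 *: x.
have v1 : sqnorm v = 1 by rewrite sqnormZ -/s -w2 exprVn mulVf// expf_neq0.
have [dc cc Uc c0 c1] := P.
pose p t := dot (c t) v; pose p' t := dot (derive1 c t) v.
have p2 t : p t ^+ 2 <= sqnorm (c t) by exact: dot_sqr_le.
have pb (t : R) : 0 <= t <= 1 -> -1 < p t < 1.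
  by move=> /Uc; rewrite /hyp_space /= => st; have p2t := p2 t; apply/andP; split; nra.
have df (t : R) : 0 <= t <= 1 ->
    is_derive t 1 (fun t => two_artanh (p t)) (2 / (1 - p t ^+ 2) * p' t).
  move=> t01; have dp := is_derive_dot v (dc t).
  exact: (@is_derive_compf _ _ p two_artanh _ _ _ _ dp (is_derive_two_artanh (pb _ t01))).
have cf (t : R) : 0 <= t <= 1 -> {for t, continuous (fun t => 2 / (1 - p t ^+ 2) * p' t)}.
  move=> t01; have cp : {for t, continuous p}.
    by apply: is_derive_continuous (is_derive_dot v (dc t)).
  apply: cvgM; last by apply: continuous_dot; [exact: cc | exact: cst_continuous].
  apply: cvgM; first exact: cvg_cst.
  apply: cvgV.
    by rewrite subr_eq0 gt_eqF// (le_lt_trans (p2 t))//; exact: Uc.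
  apply: cvgB; first exact: cvg_cst.
  exact: cvgM.
have -> : two_artanh w = two_artanh (p 1) - two_artanh (p 0).
  rewrite /p c0 c1; have -> : dot 0 v = 0.
    by rewrite /dot big1// => i _; rewrite mxE mul0r.
  have -> : dot x v = w.
    rewrite /dot; under eq_bigr => i _ do rewrite mxE mulrCA.
    by rewrite -mulr_sumr -/(dot x x) -sqnorm_dot -/s -w2 expr2 mulKf.
  by rewrite /two_artanh addr0 subr0 ln1 subr0 subr0.
rewrite -(integral01 df cf); apply: le_Rintegral => //.
- exact: continuous_on01_integrable.
- by apply: continuous_on01_integrable => t; exact: continuous_hyp_speed P.
move=> t; rewrite /= in_itv /= => t01.
have := Uc _ t01; rewrite /hyp_space /= => st.
apply: (@le_trans _ _ (2 / (1 - p t ^+ 2) * Num.sqrt (sqnorm (derive1 c t)))).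
  apply: ler_wpM2l; first by rewrite divr_ge0// subr_ge0 (le_trans (p2 t))// ltW.
  apply: le_trans (ler_norm _) _.
  by rewrite -sqrtr_sqr ler_wsqrtr// dot_sqr_le.
apply: ler_wpM2r; first exact: sqrtr_ge0.
rewrite ler_pM2l// lef_pV2 ?posrE ?subr_gt0//; last exact: le_lt_trans (p2 t) st.
by rewrite lerD2l lerN2.
Qed.

(** The geodesic ball is an infimum over paths; the straight path and
    [path_length_ge] compute that infimum. *)
Lemma hyp_ballE (r : R) : 0 < r ->
  @hyp_ball R n r = [set x : 'rV[R]_n | sqnorm x < tanh_half r ^+ 2].
Proof.
move=> r0; have T0 := tanh_half_gt0 r0; have T1 := tanh_half_lt1 r.
have key x : (x \in @hyp_space R n) && (two_artanh (Num.sqrt (sqnorm x)) < r) =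
    (sqnorm x < tanh_half r ^+ 2).
  have w0 : 0 <= Num.sqrt (sqnorm x) by rewrite sqrtr_ge0.
  have E : (sqnorm x < tanh_half r ^+ 2) = (Num.sqrt (sqnorm x) < tanh_half r).
    rewrite -[in LHS](sqr_sqrtr (sqnorm_ge0 x)).
    by rewrite ltr_pXn2r// ?nnegrE// ltW.
  apply/andP/idP => [[]|].
    rewrite inE /hyp_space /= => x1; rewrite two_artanh_lt ?E//.
    apply/andP; split; first lra.
    by rewrite -(@ltr_pXn2r _ 2)// ?nnegrE// sqr_sqrtr ?sqnorm_ge0// expr1n.
  rewrite E => wT; rewrite two_artanh_lt//; last by apply/andP; split; lra.
  split=> //; rewrite inE /hyp_space /=; rewrite -(sqr_sqrtr (sqnorm_ge0 x)).
  by nra.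
apply/seteqP; split => x /=.
  move=> [Ux]; rewrite /riemannian_dist => /inf_lt.
  have [P _] := straight_path Ux.
  case; first by exists (path_length (@hyp_metric R n) (fun t => t *: x)), (fun t => t *: x).
  move=> l [c Pc <-] lr; rewrite -key; apply/andP; split; first by rewrite inE.
  exact: le_lt_trans (path_length_ge Ux Pc) lr.
rewrite -key => /andP[]; rewrite inE => Ux xr; split=> //.
apply: le_lt_trans xr; have [P <-] := straight_path Ux.
apply: ge_inf; last by exists (fun t => t *: x).
exists (two_artanh (Num.sqrt (sqnorm x))) => _ [c Pc <-].
exact: path_length_ge.
Qed.

End Paths.
End HyperbolicBall.

(** * The Laplacian of the Poincare model *)

Section Laplacian.
Context {R : realType} {n : nat}.
Implicit Types (x y : 'rV[R]_n) (u f : 'rV[R]_n -> R).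

Lemma dot_basis x i : dot x 'e_i = x 0 i.
Proof.
rewrite /dot (bigD1 i)//= big1 ?addr0 => [|j ji]; first by rewrite mxE !eqxx mulr1.
by rewrite mxE eqxx (negbTE ji) mulr0.
Qed.

Lemma is_derive_sqnorm x v : is_derive x v (@sqnorm R n) (2 * dot x v).
Proof.
have := @is_derive_sumf R _ n (fun i y => y 0 i ^+ 2) x v (fun i => 2 * x 0 i * v 0 i).
move=> /(_ _)/is_derive_val; apply.
  by move=> i; differentiate; [exact: is_derive_coord | rewrite /= expr1].
by rewrite /dot mulr_sumr; apply: eq_bigr => i _; rewrite mulrA.
Qed.

Lemma sqnorm_continuous : continuous (@sqnorm R n).
Proof.
move=> x; apply: (@continuous_sum_at R n _ (fun i y => y 0 i ^+ 2)) => i.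
have cc := @coord_continuous R 1 n 0 i x.
exact: (continuous_comp cc (@exprn_continuous _ _ _)).
Qed.

Lemma sqnorm_near x (S : R) : sqnorm x < S -> \near x, sqnorm x < S.
Proof. by move=> xS; exact: (cvgr_lt (sqnorm x) (@sqnorm_continuous x) _ xS). Qed.

Lemma sqnorm_line x v (S : R) : sqnorm x < S ->
  exists2 e, 0 < e & forall t, `|t| < e -> sqnorm (t *: v + x) < S.
Proof.
move=> xS; have df : is_derive (0 : R) 1 (fun h : R => sqnorm (h *: v + x)) (2 * dot x v).
  by apply: is_derive_lineE; rewrite scale0r add0r; exact: is_derive_sqnorm.
have := is_derive_continuous df; rewrite /prop_for /continuous_at scale0r add0r.
move=> /(cvgr_lt (sqnorm x)) /(_ _ xS) /nbhs_ballP [e e0 He].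
by exists e => // t te; apply: He; rewrite /ball /= sub0r normrN.
Qed.

(** The square root of the determinant of the metric. *)
Definition hyp_density x := (2 / (1 - sqnorm x)) ^+ n.

Lemma hyp_det x : sqnorm x < 1 -> Num.sqrt (\det (hyp_metric x)) = hyp_density x.
Proof.
move=> x1; rewrite /hyp_metric det_scalar.
have -> : 4 / (1 - sqnorm x) ^+ 2 = (2 / (1 - sqnorm x)) ^+ 2.
  by field; rewrite subr_eq0 gt_eqF.
rewrite exprAC sqrtr_sqr ger0_norm// exprn_ge0// divr_ge0// subr_ge0 ltW//.
Qed.

Lemma hyp_inv_sum x f i :
  \sum_(j < n) (invmx (hyp_metric x)) i j * 'D_('e_j) f x =
  (1 - sqnorm x) ^+ 2 / 4 * 'D_('e_i) f x.
Proof.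
rewrite /hyp_metric invmx_scalar (bigD1 i)//= big1 ?addr0 => [|j ji].
  by rewrite mxE eqxx mulr1n invf_div.
by rewrite mxE eq_sym (negbTE ji) mul0r.
Qed.

Lemma natmul_pred_exp (q : R) k : k%:R * q ^+ k.-1 * q = k%:R * q ^+ k.
Proof. by case: k => [|k]; rewrite ?mul0r// -mulrA -exprSr. Qed.

(** The metric is a multiple q^2 of the Euclidean one with q = 2/(1-|x|^2), so
    the Laplacian is q^-n div(q^(n-2) grad f); the first-order term is the
    derivative of q^(n-2). *)
Lemma laplace_hypE f x : sqnorm x < 1 ->
  (forall i, derivable ('D_('e_i) f) x 'e_i) ->
  laplace_beltrami (@hyp_metric R n) f x =
  (1 - sqnorm x) ^+ 2 / 4 * \sum_i 'D_('e_i) ('D_('e_i) f) x +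
  (n%:R - 2) * (1 - sqnorm x) / 2 * \sum_i x 0 i * 'D_('e_i) f x.
Proof.
move=> x1 df; rewrite /laplace_beltrami hyp_det//.
have s1 : 1 - sqnorm x != 0 by rewrite subr_eq0 gt_eqF.
have H i : 'D_('e_i) (fun y => Num.sqrt (\det (hyp_metric y)) *
    \sum_(j < n) (invmx (hyp_metric y)) i j * 'D_('e_j) f y) x =
  hyp_density x * ((1 - sqnorm x) ^+ 2 / 4 * 'D_('e_i) ('D_('e_i) f) x +
  (n%:R - 2) * (1 - sqnorm x) / 2 * (x 0 i * 'D_('e_i) f x)).
  have nr : \near x, hyp_density x * ((1 - sqnorm x) ^+ 2 / 4 * 'D_('e_i) f x) =
     Num.sqrt (\det (hyp_metric x)) *
    \sum_(j < n) (invmx (hyp_metric x)) i j * 'D_('e_j) f x.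
    have := sqnorm_near x1; apply: filterS => y y1.
    by rewrite hyp_det// hyp_inv_sum.
  have dd := derivableP (df i).
  have ds := is_derive_sqnorm x 'e_i; rewrite dot_basis in ds.
  have := near_eq_derive 'e_i nr => <-.
  suff : is_derive x 'e_i
    (fun x => hyp_density x * ((1 - sqnorm x) ^+ 2 / 4 * 'D_('e_i) f x))
    (hyp_density x * ((1 - sqnorm x) ^+ 2 / 4 * 'D_('e_i) ('D_('e_i) f) x +
  (n%:R - 2) * (1 - sqnorm x) / 2 * (x 0 i * 'D_('e_i) f x))).
    by move=> ?; rewrite derive_val.
  rewrite /hyp_density; differentiate => //.
  have := natmul_pred_exp (2 / (1 - sqnorm x)) n.
  set Q := _ ^+ n.-1; set P := _ ^+ n => QP.
  set d := 'D_('e_i) f x; set dd' := 'D_('e_i) ('D_('e_i) f) x.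
  have -> : n%:R * Q = n%:R * P * (1 - sqnorm x) / 2.
    by rewrite -QP; field.
  by field.
under eq_bigr => i _ do rewrite H.
rewrite -mulr_sumr mulKf ?big_split /= -?mulr_sumr//.
by rewrite /hyp_density expf_neq0// mulf_neq0// invr_neq0.
Qed.
End Laplacian.

(** * Lower bounds for Dirichlet eigenvalues from positive supersolutions *)

Section Barta.
Context {R : realType} {n : nat}.
Implicit Types (x y : 'rV[R]_n) (u : 'rV[R]_n -> R).

Definition euclidean_ball (S : R) : set 'rV[R]_n := [set x | sqnorm x < S].

Lemma closure_euclidean_ball (S : R) x : closure (euclidean_ball S) x -> sqnorm x <= S.
Proof.
have cl : closed (@sqnorm R n @^-1` [set y | y <= S]).
  apply: preimage_closed; last exact: closed_le.
  by move=> y _; exact: sqnorm_continuous.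
move=> cx; suff : closure (@sqnorm R n @^-1` [set y | y <= S]) x by move/cl.
by apply: closureS cx => y /ltW.
Qed.

Lemma coord_sqr_le x i : x 0 i ^+ 2 <= sqnorm x.
Proof.
rewrite /sqnorm (bigD1 i)//= lerDl; apply: sumr_ge0 => j _; exact: sqr_ge0.
Qed.

Lemma closure_euclidean_ball_compact (S : R) : compact (closure (euclidean_ball S)).
Proof.
apply: bounded_closed_compact; last exact: closed_closure.
exists (1 + S); split; first exact: num_real.
move=> M SM x /closure_euclidean_ball xS; rewrite /Num.Def.normr/= mx_normrE.
have S0 : 0 <= S by exact: le_trans (sqnorm_ge0 x) xS.
have M0 : 0 <= M by lra.
apply: bigmax_le => //= -[i j] _ /=; rewrite (ord1 i).
rewrite -(@ler_pXn2r _ 2)// ?nnegrE// real_normK ?num_real//.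
by apply: le_trans (coord_sqr_le _ _) _; apply: le_trans xS _; nra.
Qed.

(** At a maximum c of |u|/f, with value M, the function e u - M f (e the sign
    of u c) is nonpositive around c and vanishes at c. So the first
    derivatives of e u and M f agree at c and the pure second derivatives of e
    u are at most those of M f; hence e Delta u <= M Delta f at c, which reads
    -mu M f <= -m M f. The hypotheses on f are those of a positive
    supersolution x |-> f (|x|^2). *)
Lemma barta_eigenvalue_ge (S m mu : R) (f f' f'' : R -> R) u x0 : S < 1 ->
  (forall s : R, -1 < s < 1 -> is_derive s 1 f (f' s)) ->
  (forall s : R, -1 < s < 1 -> is_derive s 1 f' (f'' s)) ->
  (forall s, 0 <= s <= S -> 0 < f s) ->
  (forall s, 0 <= s <= S ->
     (1 - s) ^+ 2 * (s * f'' s + n%:R / 2 * f' s) + (n%:R - 2) * (1 - s) * s * f' s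
       <= - m * f s) ->
  dirichlet_eigenspace (@hyp_metric R n) (euclidean_ball S) mu u ->
  euclidean_ball S x0 -> u x0 != 0 -> m <= mu.
Proof.
move=> S1 df df' f0 fL [uC2 uc ueq ubd] Bx0 ux0.
set A := closure (euclidean_ball S).
have sA x : A x -> 0 <= sqnorm x <= S.
  by move=> /closure_euclidean_ball ->; rewrite sqnorm_ge0.
have cq : {within A, continuous (fun x => `|u x| / f (sqnorm x))}.
  have c1 : {within A, continuous (fun x => (f (sqnorm x))^-1)}.
    apply: continuous_in_subspaceT => x; rewrite inE => Ax.
    have /andP[s0 sS] := sA _ Ax.
    have cs := @sqnorm_continuous R n x.
    have cf : {for sqnorm x, continuous f}.
      by apply: is_derive_continuous (df (sqnorm x) _); apply/andP; split; lra.
    have fn0 : f (sqnorm x) != 0 by rewrite gt_eqF// f0// sA.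
    exact: (cvgV fn0 (continuous_comp cs cf)).
  move=> x; apply: cvgM; last exact: c1.
  by apply: cvg_norm; exact: uc.
have A0 : A x0 by exact: subset_closure.
have [|c] := EVT_max_rV _ (@closure_euclidean_ball_compact S) cq; first by exists x0.
rewrite inE => Ac maxc.
set M := `|u c| / f (sqnorm c) in maxc.
have M0 : 0 < M.
  apply: (@lt_le_trans _ _ (`|u x0| / f (sqnorm x0))); last by apply: maxc; rewrite inE.
  by rewrite divr_gt0 ?normr_gt0// f0// sA.
have uc0 : u c != 0.
  by apply: contraTneq M0 => uc0; rewrite /M uc0 normr0 mul0r ltxx.
have Bc : euclidean_ball S c.
  have [//|nBc] := pselect (euclidean_ball S c).
  by move: uc0; rewrite (ubd c) ?eqxx.
(* the sign of u at c avoids replacing u by its opposite *)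
set e := Num.sg (u c).
have ueM : e * u c = M * f (sqnorm c).
  by rewrite -normrEsg /M divfK// gt_eqF// f0// sA.
have ule x : euclidean_ball S x -> e * u x <= M * f (sqnorm x).
  move=> Bx; have Ax : A x by exact: subset_closure.
  apply: (@le_trans _ _ `|u x|).
    by apply: le_trans (ler_norm _) _; rewrite normrM normr_sg uc0 mul1r.
  by rewrite -ler_pdivrMr ?f0 ?sA// maxc// inE.
have K i : e * 'D_('e_i) u c = M * (f' (sqnorm c) * (2 * c 0 i)) /\
  e * 'D_('e_i) ('D_('e_i) u) c <=
    M * (f'' (sqnorm c) * (2 * c 0 i) ^+ 2 + f' (sqnorm c) * 2).
  have [d d0 Hd] := sqnorm_line 'e_i Bc.
  have sq1 y : euclidean_ball S y -> -1 < sqnorm y < 1.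
    move=> By; have := sqnorm_ge0 y; rewrite /euclidean_ball /= in By.
    by move=> ?; apply/andP; split; lra.
  pose g t := e * u (t *: 'e_i + c) - M * f (sqnorm (t *: 'e_i + c)).
  pose g' t := e * 'D_('e_i) u (t *: 'e_i + c)
    - M * (f' (sqnorm (t *: 'e_i + c)) * (2 * (t *: 'e_i + c) 0 i)).
  have dsq (y : 'rV[R]_n) : is_derive y 'e_i (@sqnorm R n) (2 * y 0 i).
    by have := is_derive_sqnorm y 'e_i; rewrite dot_basis.
  have dg (t : R) : `|t - 0| < d -> is_derive t 1 g (g' t).
    rewrite subr0 => td; have By := Hd t td.
    apply: (@is_derive_lineE _ _ (fun y => e * u y - M * f (sqnorm y))).
    have [_ du _] := uC2 _ By; have du1 := derivableP (du i).1.
    have dfs := is_derive_compf (dsq _) (df _ (sq1 _ By)).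
    by differentiate; rewrite !mul0r !add0r.
  have dg' : is_derive (0 : R) 1 g' (e * 'D_('e_i) ('D_('e_i) u) c -
      M * (f'' (sqnorm c) * (2 * c 0 i) ^+ 2 + f' (sqnorm c) * 2)).
    apply: (@is_derive_lineE _ _ (fun y => e * 'D_('e_i) u y - M * (f' (sqnorm y) * (2 * y 0 i)))).
    rewrite scale0r add0r.
    have [_ _ du] := uC2 _ Bc; have du1 := derivableP (du i i).1.
    have dfs := is_derive_compf (dsq _) (df' _ (sq1 _ Bc)).
    have dci := is_derive_coord c 'e_i i.
    by differentiate; rewrite mxE !eqxx !mul0r !add0r /=; ring.
  have gmax t : `|t - 0| < d -> g t <= g 0.
    rewrite subr0 => td; rewrite /g scale0r add0r ueM subrr subr_le0.
    exact: ule (Hd t td).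
  have [] := local_max_test d0 dg dg' gmax.
  rewrite /g' scale0r add0r => /eqP; rewrite subr_eq0 => /eqP -> .
  by rewrite subr_le0.
have c1 : sqnorm c < 1 by exact: lt_trans Bc S1.
have := ueq _ Bc; rewrite laplace_hypE//; last first.
  by move=> i; have [_ _ /(_ i i) []] := uC2 _ Bc.
move=> /(congr1 (fun z => e * z)); set s := sqnorm c => Eq.
have s0 : 0 <= s by exact: sqnorm_ge0.
have E1 : e * (\sum_i c 0 i * 'D_('e_i) u c) = M * (f' s * 2 * s).
  rewrite mulr_sumr /s {2}/sqnorm !mulr_sumr; apply: eq_bigr => i _.
  by rewrite mulrCA (K i).1 -/s; ring.
have E2 : e * (\sum_i 'D_('e_i) ('D_('e_i) u) c) <=
    M * (4 * s * f'' s + n%:R * 2 * f' s).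
  rewrite mulr_sumr; apply: le_trans (ler_sum _ (fun i _ => (K i).2)) _.
  rewrite -mulr_sumr big_split /= sumr_const card_ord ler_pM2l//.
  rewrite -mulr_natl lerD//; last by rewrite mulrCA mulrC mulrA; lra.
  rewrite -mulr_sumr; under eq_bigr => i _ do rewrite exprMn.
  by rewrite -mulr_sumr -/(sqnorm c) -/s; lra.
have fL' := fL s; have {}fL' := fL' (sA _ Ac).
have fs := f0 _ (sA _ Ac); rewrite -/s in fs ueM.
rewrite -(ler_pM2r (mulr_gt0 M0 fs)).
have -> : mu * (M * f s) = mu * (e * u c) by rewrite ueM.
have -> : mu * (e * u c) = e * (mu * u c) by ring.
rewrite -Eq.
have H2 := ler_wpM2l (_ : 0 <= (1 - s) ^+ 2 / 4) E2.
have {}H2 := H2 (divr_ge0 (sqr_ge0 _) (ler0n _ _)).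
have H3 := ler_wpM2l (ltW M0) fL'.
set P := \sum_i 'D_('e_i) ('D_('e_i) u) c in E2 H2 Eq *.
set Q := \sum_i c 0 i * 'D_('e_i) u c in E1 Eq *.
have -> : e * - ((1 - s) ^+ 2 / 4 * P + (n%:R - 2) * (1 - s) / 2 * Q) =
  - ((1 - s) ^+ 2 / 4 * (e * P)) - (n%:R - 2) * (1 - s) / 2 * (e * Q) by field.
rewrite E1; lra.
Qed.
End Barta.

(** * Eigenfunctions of the form x_i k(|x|^2) *)

(** The partial derivatives of an explicit function are only known to agree
    with their formulas inside the unit ball, an open set. *)
Lemma continuous_near_eq (T : topologicalType) (R : realType) (f g : T -> R) x :
  (\near x, f x = g x) -> {for x, continuous f} -> {for x, continuous g}.
Proof.
move=> fg cf; have fgx := nbhs_singleton fg.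
rewrite /prop_for /continuous_at -fgx.
exact: (cvg_trans (near_eq_cvg fg) cf).
Qed.

Lemma continuous_atM (T : topologicalType) (R : realType) (f g : T -> R) x :
  {for x, continuous f} -> {for x, continuous g} ->
  {for x, continuous (fun y => f y * g y)}.
Proof. by move=> cf cg; exact: (cvgM cf cg). Qed.

Lemma continuous_atD (T : topologicalType) (R : realType) (f g : T -> R) x :
  {for x, continuous f} -> {for x, continuous g} ->
  {for x, continuous (fun y => f y + g y)}.
Proof. by move=> cf cg; exact: (cvgD cf cg). Qed.

Section CoordRadial.
Context {R : realType} {n : nat}.
Implicit Types (x y : 'rV[R]_n).
Variables (k k' k'' : R -> R) (i : 'I_n).
Hypothesis dk : forall s : R, -1 < s < 1 -> is_derive s 1 k (k' s).
Hypothesis dk' : forall s : R, -1 < s < 1 -> is_derive s 1 k' (k'' s).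
Hypothesis ck'' : forall s : R, -1 < s < 1 -> {for s, continuous k''}.

Definition coord_radial x := x 0 i * k (sqnorm x).

Let d1 (j : 'I_n) x :=
  (i == j)%:R * k (sqnorm x) + 2 * (x 0 i * x 0 j * k' (sqnorm x)).

Let d2 (j l : 'I_n) x :=
  2 * ((i == j)%:R * x 0 l + (i == l)%:R * x 0 j + (j == l)%:R * x 0 i) * k' (sqnorm x)
  + 4 * (x 0 i * x 0 j * x 0 l * k'' (sqnorm x)).

Let sq1 x : sqnorm x < 1 -> -1 < sqnorm x < 1.
Proof. by have := sqnorm_ge0 x => ? ?; apply/andP; split; lra. Qed.

Let is_derive_sq x (j : 'I_n) : is_derive x 'e_j (@sqnorm R n) (2 * x 0 j).
Proof. by have := is_derive_sqnorm x 'e_j; rewrite dot_basis. Qed.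

Let is_derive_co x (j l : 'I_n) : is_derive x 'e_l (fun y : 'rV[R]_n => y 0 j) (j == l)%:R.
Proof. by apply: (is_derive_val (is_derive_coord x 'e_l j)); rewrite mxE eqxx. Qed.

Let deriv_coord_radial x j : sqnorm x < 1 -> is_derive x 'e_j coord_radial (d1 j x).
Proof.
move=> x1; have dks := is_derive_compf (is_derive_sq x j) (dk (sq1 x1)).
have dci := is_derive_co x i j; rewrite /coord_radial.
by differentiate; rewrite /d1; ring.
Qed.

Let deriv_d1 x j l : sqnorm x < 1 -> is_derive x 'e_l (d1 j) (d2 j l x).
Proof.
move=> x1; have dks := is_derive_compf (is_derive_sq x l) (dk (sq1 x1)).
have dks' := is_derive_compf (is_derive_sq x l) (dk' (sq1 x1)).
have dci := is_derive_co x i l; have dcj := is_derive_co x j l; rewrite /d1.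
by differentiate; rewrite /d2; ring.
Qed.

Let deriv1E x j : sqnorm x < 1 -> 'D_('e_j) coord_radial x = d1 j x.
Proof. by move=> x1; have := deriv_coord_radial j x1 => ?; rewrite derive_val. Qed.

Let near_d1 x j : sqnorm x < 1 -> \near x, d1 j x = 'D_('e_j) coord_radial x.
Proof. by move=> /sqnorm_near; apply: filterS => y y1; rewrite deriv1E. Qed.

Let deriv_D x j l : sqnorm x < 1 ->
  is_derive x 'e_l ('D_('e_j) coord_radial) (d2 j l x).
Proof. by move=> x1; exact: near_eq_is_derive (near_d1 j x1) (deriv_d1 j l x1). Qed.

Let deriv2E x j l : sqnorm x < 1 ->
  'D_('e_l) ('D_('e_j) coord_radial) x = d2 j l x.
Proof. by move=> x1; have := deriv_D j l x1 => ?; rewrite derive_val. Qed.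

Let near_d2 x j l : sqnorm x < 1 ->
  \near x, d2 j l x = 'D_('e_l) ('D_('e_j) coord_radial) x.
Proof. by move=> /sqnorm_near; apply: filterS => y y1; rewrite deriv2E. Qed.

Let cont_rad (f : R -> R) x : {for sqnorm x, continuous f} ->
  {for x, continuous (fun x => f (sqnorm x))}.
Proof. by move=> cf; exact: (continuous_comp (@sqnorm_continuous R n x) cf). Qed.

Let cont_co x j : {for x, continuous (fun x : 'rV[R]_n => x 0 j)}.
Proof. exact: (@coord_continuous R 1 n 0 j x). Qed.

Let cont_k x : sqnorm x < 1 -> {for x, continuous (fun x => k (sqnorm x))}.
Proof. by move=> /sq1 x1; apply: cont_rad; exact: is_derive_continuous (dk x1). Qed.

Let cont_k' x : sqnorm x < 1 -> {for x, continuous (fun x => k' (sqnorm x))}.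
Proof. by move=> /sq1 x1; apply: cont_rad; exact: is_derive_continuous (dk' x1). Qed.

Let cont_k'' x : sqnorm x < 1 -> {for x, continuous (fun x => k'' (sqnorm x))}.
Proof. by move=> /sq1 x1; apply: cont_rad; exact: ck'' x1. Qed.

Let cont0 x : sqnorm x < 1 -> {for x, continuous coord_radial}.
Proof. by move=> x1; exact: (cvgM (@cont_co x i) (cont_k x1)). Qed.

Let cont_cst (a : R) x : {for x, continuous (fun _ : 'rV[R]_n => a)}.
Proof. by move=> A Aa; exact: (@cvg_cst _ _ _ (nbhs x) _ _ Aa). Qed.

Let cont1 x j : sqnorm x < 1 -> {for x, continuous ('D_('e_j) coord_radial)}.
Proof.
move=> x1; apply: continuous_near_eq (near_d1 j x1) _.
have ck := cont_k x1; have ck' := cont_k' x1.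
have cc := @cont_co x; have c0 (a : R) := @cont_cst a x.
exact: (continuous_atD (continuous_atM (c0 _) ck)
  (continuous_atM (c0 _) (continuous_atM (continuous_atM (cc _) (cc _)) ck'))).
Qed.

Let cont2 x j l : sqnorm x < 1 ->
  {for x, continuous ('D_('e_l) ('D_('e_j) coord_radial))}.
Proof.
move=> x1; apply: continuous_near_eq (near_d2 j l x1) _.
have ck'2 := cont_k'' x1; have ck' := cont_k' x1.
have cc := @cont_co x; have c0 (a : R) := @cont_cst a x.
have c1 a b := continuous_atM (c0 a) (cc b).
apply: (continuous_atD (continuous_atM (continuous_atM (c0 _)
  (continuous_atD (continuous_atD (c1 _ _) (c1 _ _)) (c1 _ _))) ck')).
exact: (continuous_atM (c0 _)
  (continuous_atM (continuous_atM (continuous_atM (cc _) (cc _)) (cc _)) ck'2)).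
Qed.

(** The equation for k is what remains of the eigenvalue equation after
    factoring x_i out of the Laplacian of x_i k(|x|^2). *)
Lemma coord_radial_eigenfunction (S lam : R) : S < 1 ->
  (forall s, 0 <= s < S ->
     (1 - s) ^+ 2 * (s * k'' s + (n%:R / 2 + 1) * k' s)
     + (n%:R - 2) * (1 - s) * (k s / 2 + s * k' s) + lam * k s = 0) ->
  k S = 0 ->
  dirichlet_eigenspace (@hyp_metric R n) (euclidean_ball S) lam coord_radial.
Proof.
move=> S1 ode kS.
have B1 x : euclidean_ball S x -> sqnorm x < 1 by move=> Bx; exact: lt_trans Bx S1.
split.
- move=> x /B1 x1; split; first exact: cont0.
  + by move=> j; split; [have := deriv_coord_radial j x1 => ?; exact: ex_derive | exact: cont1].
  + move=> j l; split; last exact: cont2.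
    by have := deriv_D j l x1 => ?; exact: ex_derive.
- apply: continuous_in_subspaceT => x; rewrite inE => /closure_euclidean_ball xS.
  by apply: cont0; exact: le_lt_trans xS S1.
- move=> x Bx; have x1 := B1 _ Bx.
  rewrite laplace_hypE//; last by move=> j; have := deriv_D j j x1 => ?; exact: ex_derive.
  set s := sqnorm x.
  have E2 : \sum_j 'D_('e_j) ('D_('e_j) coord_radial) x =
      x 0 i * ((2 * n%:R + 4) * k' s + 4 * s * k'' s).
    under eq_bigr => j _.
      rewrite deriv2E// /d2 -/s eqxx.
      have -> : 2 * ((i == j)%:R * x 0 j + (i == j)%:R * x 0 j + true%:R * x 0 i) * k' s +
        4 * (x 0 i * x 0 j * x 0 j * k'' s) = (i == j)%:R * (4 * x 0 j * k' s) +
        (2 * x 0 i * k' s + (4 * x 0 i * k'' s) * x 0 j ^+ 2) by rewrite /=; ring.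
      over.
    rewrite big_split /= (bigD1 i)//= big1 ?addr0 => [|j ji]; last first.
      by rewrite eq_sym (negbTE ji) mul0r.
    rewrite big_split /= sumr_const card_ord -mulr_sumr -/(sqnorm x) -/s eqxx.
    by rewrite -[_ *+ n]mulr_natl /=; ring.
  have E1 : \sum_j x 0 j * 'D_('e_j) coord_radial x = x 0 i * (k s + 2 * s * k' s).
    under eq_bigr => j _.
      rewrite deriv1E// /d1 -/s.
      have -> : x 0 j * ((i == j)%:R * k s + 2 * (x 0 i * x 0 j * k' s)) =
        (i == j)%:R * (x 0 j * k s) + (2 * x 0 i * k' s) * x 0 j ^+ 2 by ring.
      over.
    rewrite big_split /= (bigD1 i)//= big1 ?addr0 => [|j ji]; last first.
      by rewrite eq_sym (negbTE ji) mul0r.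
    by rewrite -mulr_sumr -/(sqnorm x) -/s eqxx /=; ring.
  rewrite E1 E2 /coord_radial -/s.
  have /ode H : 0 <= s < S by rewrite sqnorm_ge0.
  have -> : lam * (x 0 i * k s) = x 0 i * (lam * k s) by ring.
  have -> : lam * k s = - ((1 - s) ^+ 2 * (s * k'' s + (n%:R / 2 + 1) * k' s)
     + (n%:R - 2) * (1 - s) * (k s / 2 + s * k' s)) by lra.
  by field.
- move=> x [/closure_euclidean_ball xS nBx]; rewrite /coord_radial.
  have -> : sqnorm x = S.
    by apply/eqP; rewrite eq_le xS leNgt; apply/negP => /nBx.
  by rewrite kS mulr0.
Qed.
End CoordRadial.

(** * Power series, and the recurrence of the radial equation *)

Section PowerSeries.
Context {R : realType}.
Implicit Types (a b : nat -> R) (q s : R).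

(** A form of having radius of convergence at least 1 that is stable under the
    operations needed below and easy to check on a recurrence. *)
Definition radius_ge1 a := forall q, 0 < q < 1 ->
  exists C, forall k, `|a k| * q ^+ k <= C.

Definition psum a s := limn (pseries a s).

(** The coefficients of X times the series. *)
Definition coef_mulX a k := if k is k'.+1 then a k' else 0.

Lemma radius_ge1_le a b : (forall k, `|a k| <= b k) -> radius_ge1 b -> radius_ge1 a.
Proof.
move=> ab gb q q01; have [C HC] := gb q q01; exists C => k.
apply: le_trans (HC k); apply: ler_wpM2r; first by rewrite exprn_ge0//; lra.
exact: le_trans (ab k) (ler_norm _).
Qed.

Lemma radius_ge1D a b : radius_ge1 a -> radius_ge1 b -> radius_ge1 (fun k => a k + b k).
Proof.
move=> ga gb q q01; have [A HA] := ga q q01; have [B HB] := gb q q01.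
exists (A + B) => k; apply: le_trans (lerD (HA k) (HB k)); rewrite -mulrDl.
by apply: ler_wpM2r; [rewrite exprn_ge0//; lra | exact: ler_normD].
Qed.

Lemma radius_ge1Z c a : radius_ge1 a -> radius_ge1 (fun k => c * a k).
Proof.
move=> ga q q01; have [A HA] := ga q q01; exists (`|c| * A) => k.
by rewrite normrM -mulrA ler_wpM2l.
Qed.

Lemma radius_ge1_shift a : radius_ge1 a -> radius_ge1 (coef_mulX a).
Proof.
move=> ga q q01; have [A HA] := ga q q01; exists A => -[|k] /=.
  by rewrite normr0 mul0r; apply: le_trans (HA 0%N); rewrite mulr_ge0// exprn_ge0//; lra.
apply: le_trans (HA k); apply: ler_wpM2l => //.
by rewrite exprS ler_piMl ?exprn_ge0//; lra.
Qed.

(** Bernoulli's inequality: r^-k grows at least linearly. *)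
Lemma natmul_exp_bounded (r : R) : 0 < r < 1 -> exists C, forall k, k.+1%:R * r ^+ k <= C.
Proof.
move=> /andP[r0 r1]; pose h := r^-1 - 1.
have h0 : 0 < h by rewrite subr_gt0 invf_gt1.
have hk k : 1 + k%:R * h <= (1 + h) ^+ k.
  elim: k => [|k IH]; first by rewrite mul0r addr0 expr0.
  rewrite exprSr; apply: le_trans (_ : (1 + k%:R * h) * (1 + h) <= _).
    rewrite -natr1; have := ler0n R k; nra.
  by apply: ler_wpM2r => //; lra.
exists (1 + h^-1) => k.
have E : r ^+ k = (1 + h) ^- k by rewrite /h addrC subrK exprVn invrK.
have p0 : 0 < (1 + h) ^+ k by apply: exprn_gt0; lra.
rewrite E ler_pdivrMr//; apply: le_trans (_ : (1 + h^-1) * (1 + k%:R * h) <= _).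
  have -> : (1 + h^-1) * (1 + k%:R * h) = k.+1%:R + k%:R * h + h^-1.
    by rewrite -natr1; field; rewrite gt_eqF.
  have hi : 0 < h^-1 by rewrite invr_gt0.
  have := ler0n R k; nra.
by apply: ler_wpM2l => //; rewrite addr_ge0// invr_ge0 ltW.
Qed.

Lemma radius_ge1_diffs a : radius_ge1 a -> radius_ge1 (pseries_diffs a).
Proof.
move=> ga q /andP[q0 q1]; pose p := (q + 1) / 2.
have p0 : 0 < p by rewrite /p; lra.
have [|A HA] := ga p; first by apply/andP; split; rewrite /p; lra.
have [|C HC] := @natmul_exp_bounded (q / p).
  by apply/andP; split; [rewrite divr_gt0 | rewrite ltr_pdivrMr// /p; lra].
exists (C * (A / p)) => k; rewrite /pseries_diffs normrM normr_nat.
have -> : k.+1%:R * `|a k.+1| * q ^+ k =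
  (k.+1%:R * (q / p) ^+ k) * ((`|a k.+1| * p ^+ k.+1) / p).
  rewrite expr_div_n exprS; field.
  by rewrite expf_neq0 ?gt_eqF.
apply: ler_pM => //.
- by rewrite mulr_ge0// exprn_ge0// divr_ge0// ltW.
- apply: divr_ge0; last exact: ltW.
  by apply: mulr_ge0 => //; apply: exprn_ge0; exact: ltW.
- by rewrite ler_pM2r ?invr_gt0.
Qed.

Lemma psum_cvg a s : radius_ge1 a -> `|s| < 1 -> cvgn (pseries a s).
Proof.
move=> ga s1; pose q := (`|s| + 1) / 2.
have s0 := normr_ge0 s.
have q0 : 0 < q by rewrite /q; lra.
have [|A HA] := ga q; first by apply/andP; split; rewrite /q; lra.
apply: normed_cvg; apply: (@series_le_cvg _ _ (geometric A (`|s| / q))) => [k|k|k|].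
- exact: normr_ge0.
- rewrite /geometric/= mulr_ge0 ?exprn_ge0 ?divr_ge0// ?(ltW q0)//.
  by apply: le_trans (HA 0%N); rewrite mulr_ge0// exprn_ge0// ltW.
- rewrite /geometric /= normrM normrX expr_div_n mulrA [leRHS]mulrAC.
  apply: ler_wpM2r; first exact: exprn_ge0.
  by rewrite ler_pdivlMr ?exprn_gt0.
apply: is_cvg_geometric_series; rewrite normrM normr_id normfV (gtr0_norm q0).
by rewrite ltr_pdivrMr// /q; lra.
Qed.

Lemma is_derive_psum a s : radius_ge1 a -> -1 < s < 1 ->
  is_derive s 1 (psum a) (psum (pseries_diffs a) s).
Proof.
move=> ga s1; have {}s1 : `|s| < 1 by rewrite ltr_norml.
pose K := (`|s| + 1) / 2; have s0 := normr_ge0 s.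
have K1 : `|K| < 1 by rewrite ger0_norm /K; lra.
apply: (@pseries_snd_diffs R a K s).
- exact: psum_cvg.
- by apply: psum_cvg => //; exact: radius_ge1_diffs.
- by apply: psum_cvg => //; do 2 apply: radius_ge1_diffs.
- by rewrite (@ger0_norm _ K) /K; lra.
Qed.

Lemma psumD a b s : radius_ge1 a -> radius_ge1 b -> `|s| < 1 ->
  psum (fun k => a k + b k) s = psum a s + psum b s.
Proof.
move=> ga gb s1; have ca := psum_cvg ga s1; have cb := psum_cvg gb s1.
rewrite /psum -[RHS](lim_seriesD ca cb); congr (limn (series _)).
by apply/funext => k; exact: mulrDl.
Qed.

Lemma psumZ c a s : radius_ge1 a -> `|s| < 1 ->
  psum (fun k => c * a k) s = c * psum a s.
Proof.
move=> ga s1; have ca := psum_cvg ga s1.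
rewrite /psum -[RHS](lim_seriesZ c ca); congr (limn (series _)).
by apply/funext => k; exact/esym/mulrA.
Qed.

Lemma psum_shift a s : radius_ge1 a -> `|s| < 1 -> psum (coef_mulX a) s = s * psum a s.
Proof.
move=> ga s1; have ca := psum_cvg ga s1.
rewrite /psum -[RHS](lim_seriesZ s ca); apply: cvg_lim => //.
rewrite -cvg_shiftS.
have -> : (fun m => pseries (coef_mulX a) s m.+1) =
    series (s *: (fun k => a k * s ^+ k)).
  apply/funext => m; rewrite /pseries /series /= big_nat_recl//= mul0r add0r.
  by apply: eq_bigr => k _; rewrite exprS mulrCA.
exact: is_cvg_seriesZ.
Qed.

(** Comparison with a majorant, evaluated at a possibly larger point so that
    the bound is uniform in s. *)
Lemma psum_le a b s t : radius_ge1 b -> 0 <= s <= t -> t < 1 ->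
  (forall k, `|a k| <= b k) -> `|psum a s| <= psum b t.
Proof.
move=> gb /andP[s0 st] t1 ab; have t0 : 0 <= t by exact: le_trans st.
have cb : cvgn (pseries b t) by apply: psum_cvg => //; rewrite ger0_norm.
have le k : `|a k * s ^+ k| <= b k * t ^+ k.
  rewrite normrM normrX (ger0_norm s0).
  apply: ler_pM; [exact: normr_ge0 | exact: exprn_ge0 | exact: ab |].
  by rewrite lerXn2r// nnegrE.
have cn : cvgn [normed series (fun k => a k * s ^+ k)].
  apply: (series_le_cvg _ _ le cb) => k; first exact: normr_ge0.
  exact: le_trans (normr_ge0 _) (le k).
exact: le_trans (lim_series_norm cn) (lim_series_le cn cb le).
Qed.

Lemma psum_head a s : (forall k, a k.+1 * s ^+ k.+1 = 0) -> psum a s = a 0%N.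
Proof.
move=> az; apply: cvg_lim => //; rewrite -cvg_shiftS.
have -> : (fun m => pseries a s m.+1) = (fun=> a 0%N).
  apply/funext => m; rewrite /pseries /series /= big_nat_recl//= expr0 mulr1.
  by rewrite big1 ?addr0.
exact: cvg_cst.
Qed.
End PowerSeries.

Section HyperbolicSeries.
Context {R : realType} {n : nat}.
Implicit Types (c d mu : R) (k : nat).

(** Half of the dimension n + 2 in which the series solves the radial
    equation. *)
Definition rindex : R := n%:R / 2 + 1.

(** Expanding 1/(1-s) and 1/(1-s)^2 in the radial equation s H'' + (n/2+1) H'
    + n s H'/(1-s) + mu H/(1-s)^2 = 0 gives the recurrence (k+1) (k + n/2 + 1)
    a_(k+1) = sum_(j <= k) (c j + d (k-j+1)) a_j with c = -n and d = -mu. The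
    state carries a_k together with the sums of j a_j, of a_j and of (k-j+1)
    a_j over j <= k, so that the recurrence becomes a one-step recursion.
    Replacing c and d by larger nonnegative numbers gives majorants whose
    radius of convergence is still at least 1; absolute values in the
    three-term recurrence that comes from (1-s)^2 times the equation would
    lower the radius. *)
Fixpoint rstate c d k : R * R * R * R :=
  if k is k'.+1 then
    let: (_, A, B, D) := rstate c d k' in
    let a := (c * A + d * D) / (k'.+1%:R * (k'%:R + rindex)) in
    (a, A + k'.+1%:R * a, B + a, D + (B + a))
  else (1, 0, 1, 1).

Definition rcoef c d k := (rstate c d k).1.1.1.
Definition rmoment c d k := (rstate c d k).1.1.2.
Definition rsum c d k := (rstate c d k).1.2.
Definition rsum2 c d k := (rstate c d k).2.

Lemma rcoefS c d k : rcoef c d k.+1 =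
  (c * rmoment c d k + d * rsum2 c d k) / (k.+1%:R * (k%:R + rindex)).
Proof. by rewrite /rcoef /rmoment /rsum2 /=; case: (rstate c d k) => [[[]]]. Qed.

Lemma rmomentS c d k : rmoment c d k.+1 = rmoment c d k + k.+1%:R * rcoef c d k.+1.
Proof. by rewrite /rcoef /rmoment /=; case: (rstate c d k) => [[[]]]. Qed.

Lemma rsumS c d k : rsum c d k.+1 = rsum c d k + rcoef c d k.+1.
Proof. by rewrite /rcoef /rsum /=; case: (rstate c d k) => [[[]]]. Qed.

Lemma rsum2S c d k : rsum2 c d k.+1 = rsum2 c d k + rsum c d k.+1.
Proof. by rewrite /rsum /rsum2 /=; case: (rstate c d k) => [[[]]]. Qed.

Lemma rindex_ge1 : 1 <= rindex.
Proof. by rewrite /rindex lerDr divr_ge0. Qed.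

Lemma rden_gt0 k : 0 < k.+1%:R * (k%:R + rindex).
Proof.
have := rindex_ge1; have := ler0n R k; rewrite -natr1 => ? ?.
by apply: mulr_gt0; lra.
Qed.

Lemma rstate_ge0 c d k : 0 <= c -> 0 <= d ->
  [/\ 0 <= rcoef c d k, 0 <= rmoment c d k, 0 <= rsum c d k & 0 <= rsum2 c d k].
Proof.
move=> c0 d0; elim: k => [|k [a0 A0 S0 D0]]; first by split.
have a1 : 0 <= rcoef c d k.+1.
  by rewrite rcoefS divr_ge0 ?(ltW (rden_gt0 k))// addr_ge0// mulr_ge0.
by rewrite rmomentS rsum2S rsumS; split; rewrite ?addr_ge0// ?mulr_ge0.
Qed.

Lemma rstate_growth c d k : 0 <= c -> 0 <= d ->
  [/\ rcoef c d k <= rsum c d k, rmoment c d k <= k%:R * rsum c d k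
    & rsum2 c d k <= k.+1%:R * rsum c d k].
Proof.
move=> c0 d0; elim: k => [|k [aS AS DS]]; first by rewrite mul0r mul1r; split.
have [a0 A0 S0 D0] := rstate_ge0 k c0 d0; have [a1 _ _ _] := rstate_ge0 k.+1 c0 d0.
rewrite rmomentS rsum2S rsumS; split.
- by rewrite lerDr.
- rewrite mulrDr lerD2r; apply: le_trans AS _.
  by apply: ler_wpM2r => //; rewrite ler_nat.
- rewrite -[k.+2%:R]natr1 mulrDl mul1r lerD2r; apply: le_trans DS _.
  by apply: ler_wpM2l => //; rewrite lerDl.
Qed.

(** By [rstate_growth] a_(k+1) is at most (c+d)/(k+n/2+1) times the sum S_k of
    the coefficients up to a_k, and S_k q^k <= C/(1-q) propagates along with
    a_k q^k <= C. Once k >= (c+d)/(1-q) the first estimate yields the bound C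
    for a_(k+1) from the second. *)
Lemma radius_ge1_rcoef c d : 0 <= c -> 0 <= d -> radius_ge1 (rcoef c d).
Proof.
move=> c0 d0 q /andP[q0 q1].
have q10 : 0 < 1 - q by rewrite subr_gt0.
pose K := Num.bound ((c + d) / (1 - q)).
have KE : (c + d) / (1 - q) <= K%:R.
  by apply: ltW; apply: archi_boundP;
  apply: divr_ge0; [exact: addr_ge0 | exact: ltW].
(* the sums increase, so this also bounds the finitely many terms before K *)
pose C := rsum c d K.
have C0 : 0 <= C by have [] := rstate_ge0 K c0 d0.
have Smono k : rsum c d k <= rsum c d k.+1.
  by rewrite rsumS lerDl; have [] := rstate_ge0 k.+1 c0 d0.
have Smono' j k : (j <= k)%N -> rsum c d j <= rsum c d k.
  by move=> jk; rewrite -(subnKC jk); elim: (k - j)%N => [|i IH];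
    [rewrite addn0 | rewrite addnS; exact: le_trans IH (Smono _)].
have qk k : 0 < q ^+ k <= 1 by rewrite exprn_gt0// exprn_ile1// ltW.
have small k : (k <= K)%N -> rcoef c d k * q ^+ k <= C.
  move=> kK; have [a0 _ _ _] := rstate_ge0 k c0 d0; have [aS _ _] := rstate_growth k c0 d0.
  have /andP[q1' q2'] := qk k.
  by apply: le_trans (Smono' _ _ kK); apply: le_trans aS; rewrite ler_piMr.
have big k : rcoef c d (K + k) * q ^+ (K + k) <= C /\
    rsum c d (K + k) * q ^+ (K + k) <= C / (1 - q).
  elim: k => [|k [IHa IHS]].
    rewrite addn0; split; first exact: small.
    rewrite ler_pdivlMr// -[leRHS]mulr1 -mulrA; apply: ler_wpM2l => //.
    by have /andP[q1' q2'] := qk K; nra.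
  rewrite addnS; set m := (K + k)%N in IHa IHS *.
  have [a0 A0 S0 D0] := rstate_ge0 m c0 d0; have [aS AS DS] := rstate_growth m c0 d0.
  have Km : (c + d) / (1 - q) <= m%:R.
    by apply: le_trans KE _; rewrite ler_nat leq_addr.
  have S1 : rcoef c d m.+1 * q ^+ m.+1 <= C.
    have B : rcoef c d m.+1 <= (c + d) / (m%:R + rindex) * rsum c d m.
      rewrite rcoefS ler_pdivrMr ?rden_gt0//.
      have -> : (c + d) / (m%:R + rindex) * rsum c d m * (m.+1%:R * (m%:R + rindex)) =
        (c + d) * (m.+1%:R * rsum c d m).
        field; have := rindex_ge1; have := ler0n R m => ? ?; rewrite gt_eqF//; lra.
      have AS' : rmoment c d m <= m.+1%:R * rsum c d m.
        by apply: le_trans AS _; apply: ler_wpM2r => //; rewrite ler_nat.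
      by rewrite mulrDl lerD// ler_wpM2l.
    have F : (c + d) / (m%:R + rindex) <= 1 - q.
      have := rindex_ge1 => N1; have m0 := ler0n R m.
      rewrite ler_pdivrMr; last by lra.
      by move: Km; rewrite ler_pdivrMr//; nra.
    have {}B : rcoef c d m.+1 <= (1 - q) * rsum c d m.
      by apply: le_trans B _; apply: ler_wpM2r.
    rewrite exprS mulrCA; apply: (@le_trans _ _ (q * C)); last by rewrite ler_piMl// ltW.
    apply: ler_wpM2l; first exact: ltW.
    move: IHS; rewrite ler_pdivlMr// => IHS; apply: le_trans IHS.
    have /andP[/ltW q1' _] := qk m.
    by apply: le_trans (ler_wpM2r q1' B) _; rewrite -mulrA mulrC.
  split=> //; rewrite rsumS mulrDl.
  have -> : C / (1 - q) = q * (C / (1 - q)) + C by field; rewrite gt_eqF.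
  apply: lerD => //; rewrite exprS mulrCA; apply: ler_wpM2l => //; exact: ltW.
exists C => k; have [a0 _ _ _] := rstate_ge0 k c0 d0; rewrite ger0_norm//.
have [/small//|/ltnW Kk] := leqP k K.
by rewrite -(subnKC Kk); have [] := big (k - K)%N.
Qed.

Lemma rstate_majorant c d c' d' k : `|c| <= c' -> `|d| <= d' ->
  [/\ `|rcoef c d k| <= rcoef c' d' k, `|rmoment c d k| <= rmoment c' d' k,
      `|rsum c d k| <= rsum c' d' k & `|rsum2 c d k| <= rsum2 c' d' k].
Proof.
move=> cc dd; elim: k => [|k [a0 A0 S0 D0]].
  by split; rewrite /rcoef /rmoment /rsum /rsum2 /= ?normr0 ?normr1.
have a1 : `|rcoef c d k.+1| <= rcoef c' d' k.+1.
  rewrite !rcoefS normrM normfV (gtr0_norm (rden_gt0 k)) ler_pM2r ?invr_gt0 ?rden_gt0//.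
  by apply: le_trans (ler_normD _ _) _; rewrite !normrM; apply: lerD; apply: ler_pM.
have A1 : `|rmoment c d k.+1| <= rmoment c' d' k.+1.
  rewrite !rmomentS; apply: le_trans (ler_normD _ _) _; apply: lerD => //.
  by rewrite normrM normr_nat ler_wpM2l.
have S1 : `|rsum c d k.+1| <= rsum c' d' k.+1.
  by rewrite !rsumS; apply: le_trans (ler_normD _ _) _; apply: lerD.
split=> //; rewrite !rsum2S; apply: le_trans (ler_normD _ _) _; exact: lerD.
Qed.

(** In the step from k to k+1 the change of d contributes the majorant of the
    second sum once more, which is absorbed by passing from the factor k to
    k+1 since d' >= 1. *)
Lemma rstate_lipschitz c d e c' d' k : `|c| <= c' -> `|d| <= d' -> `|e| <= d' -> 1 <= d' ->
  [/\ `|rcoef c d k - rcoef c e k| <= `|d - e| * (k%:R * rcoef c' d' k),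
      `|rmoment c d k - rmoment c e k| <= `|d - e| * (k%:R * rmoment c' d' k),
      `|rsum c d k - rsum c e k| <= `|d - e| * (k%:R * rsum c' d' k) &
      `|rsum2 c d k - rsum2 c e k| <= `|d - e| * (k%:R * rsum2 c' d' k)].
Proof.
move=> cc dd ee d1.
have c0 : 0 <= c' by exact: le_trans (normr_ge0 _) cc.
have d0 : 0 <= d' by lra.
have mono i (x y : R) : `|x| <= `|d - e| * (i%:R * y) -> 0 <= y ->
    `|x| <= `|d - e| * (i.+1%:R * y).
  move=> H y0; apply: le_trans H _; apply: ler_wpM2l => //.
  by apply: ler_wpM2r => //; rewrite ler_nat.
elim: k => [|k [a0 A0 S0 D0]].
  by split; rewrite /rcoef /rmoment /rsum /rsum2 /= subrr normr0 mul0r mulr0.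
have [_ A'0 S'0 D'0] := rstate_ge0 k c0 d0.
have [_ _ _ De] := rstate_majorant k cc ee.
have a1 : `|rcoef c d k.+1 - rcoef c e k.+1| <= `|d - e| * (k.+1%:R * rcoef c' d' k.+1).
  rewrite !rcoefS -mulrBl normrM normfV (gtr0_norm (rden_gt0 k)) !mulrA.
  rewrite ler_pM2r ?invr_gt0 ?rden_gt0//.
  have -> : c * rmoment c d k + d * rsum2 c d k - (c * rmoment c e k + e * rsum2 c e k) =
    c * (rmoment c d k - rmoment c e k) +
    (d * (rsum2 c d k - rsum2 c e k) + (d - e) * rsum2 c e k).
    by ring.
  have -> : `|d - e| * k.+1%:R * (c' * rmoment c' d' k + d' * rsum2 c' d' k) =
    c' * (`|d - e| * (k.+1%:R * rmoment c' d' k)) + (d' * (`|d - e| * (k%:R * rsum2 c' d' k)) +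
    `|d - e| * (d' * rsum2 c' d' k)) by rewrite -natr1; ring.
  apply: le_trans (ler_normD _ _) _; apply: lerD.
    by rewrite normrM; apply: ler_pM => //; exact: mono.
  apply: le_trans (ler_normD _ _) _; rewrite !normrM; apply: lerD; first exact: ler_pM.
  apply: ler_wpM2l => //; apply: le_trans De _; rewrite ler_peMl//.
have A1 : `|rmoment c d k.+1 - rmoment c e k.+1| <= `|d - e| * (k.+1%:R * rmoment c' d' k.+1).
  rewrite !rmomentS opprD addrACA -mulrBr [X in _ <= _ * X]mulrDr [leRHS]mulrDr.
  apply: le_trans (ler_normD _ _) _; apply: lerD; first exact: mono.
  by rewrite normrM normr_nat mulrCA ler_wpM2l.
have S1 : `|rsum c d k.+1 - rsum c e k.+1| <= `|d - e| * (k.+1%:R * rsum c' d' k.+1).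
  rewrite !rsumS opprD addrACA [X in _ <= _ * X]mulrDr [leRHS]mulrDr.
  by apply: le_trans (ler_normD _ _) _; apply: lerD => //; exact: mono.
split=> //; rewrite !rsum2S opprD addrACA [X in _ <= _ * X]mulrDr [leRHS]mulrDr.
by apply: le_trans (ler_normD _ _) _; apply: lerD => //; exact: mono.
Qed.

End HyperbolicSeries.

(** * The radial equation *)

Lemma nonincreasing_on (R : realType) (f f' : R -> R) (a b : R) :
  (forall t : R, a <= t <= b -> is_derive t 1 f (f' t)) ->
  (forall t, a < t < b -> f' t <= 0) ->
  forall x y, a <= x -> x <= y -> y <= b -> f y <= f x.
Proof.
move=> df f'0 x y ax; rewrite le_eqVlt => /predU1P[->//|xy] yb.
have [| |c] := @MVT R f f' x y xy.
- move=> t; rewrite in_itv /= => /andP[t1 t2]; apply: df; apply/andP; split; lra.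
- apply: derivable_within_continuous => t; rewrite in_itv /= => /andP[t1 t2].
  have dft : is_derive t 1 f (f' t) by apply: df; apply/andP; split; lra.
  exact: ex_derive.
rewrite in_itv /= => /andP[c1 c2] E; rewrite -subr_le0 E.
rewrite mulr_le0_ge0 ?subr_ge0 ?(ltW xy)//.
by apply: f'0; apply/andP; split; lra.
Qed.

Section RadialSolution.
Context {R : realType} {n : nat}.
Implicit Types (s t mu nu S : R).

Definition regular_coef mu : nat -> R := @rcoef R n (- n%:R) (- mu).
(** The solution of the radial equation for dimension n + 2 and eigenvalue mu
    that is regular at the origin, as a function of s = |x|^2. *)
Definition regular mu : R -> R := psum (regular_coef mu).
Definition regular' mu : R -> R := psum (pseries_diffs (regular_coef mu)).
Definition regular'' mu : R -> R := psum (pseries_diffs (pseries_diffs (regular_coef mu))).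

Lemma regular_coef_le mu (L : R) k : `|mu| <= L -> `|regular_coef mu k| <= @rcoef R n n%:R L k.
Proof.
move=> muL; have [] // := @rstate_majorant R n (- n%:R) (- mu) n%:R L k.
- by rewrite normrN normr_nat.
- by rewrite normrN.
Qed.

Lemma radius_ge1_regular_coef mu : radius_ge1 (regular_coef mu).
Proof.
apply: (@radius_ge1_le _ _ (@rcoef R n n%:R `|mu|)).
  by move=> k; exact: regular_coef_le.
exact: radius_ge1_rcoef.
Qed.

Lemma is_derive_regular mu s : -1 < s < 1 -> is_derive s 1 (regular mu) (regular' mu s).
Proof. exact/is_derive_psum/radius_ge1_regular_coef. Qed.

Lemma is_derive_regular' mu s : -1 < s < 1 -> is_derive s 1 (regular' mu) (regular'' mu s).
Proof. exact/is_derive_psum/radius_ge1_diffs/radius_ge1_regular_coef. Qed.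

Lemma continuous_regular'' mu s : -1 < s < 1 -> {for s, continuous (regular'' mu)}.
Proof.
move=> s1; apply: is_derive_continuous (is_derive_psum _ s1).
by do 2 apply: radius_ge1_diffs; exact: radius_ge1_regular_coef.
Qed.

Lemma regular_at0 mu : regular mu 0 = 1.
Proof. by rewrite /regular psum_head// => k; rewrite expr0n mulr0. Qed.

Lemma regular_mu0 s : regular 0 s = 1.
Proof.
have z k : @rmoment R n (- n%:R) (- 0) k = 0 /\ regular_coef 0 k.+1 = 0.
  elim: k => [|k [A0 a0]].
    by rewrite /regular_coef rcoefS /rmoment /= oppr0 mulr0 mul0r addr0 mul0r.
  have A1 : @rmoment R n (- n%:R) (- 0) k.+1 = 0.
    by rewrite rmomentS A0 -/(regular_coef 0 k.+1) a0 mulr0 addr0.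
  by split=> //; rewrite /regular_coef rcoefS A1 oppr0 mulr0 mul0r addr0 mul0r.
by rewrite /regular psum_head// => k; have [_ ->] := z k; rewrite mul0r.
Qed.

(** After multiplication by (1-s)^2 the two sums of the recurrence disappear
    by taking differences twice, and the equation becomes an identity between
    coefficients. *)
Lemma regular_ode mu s : `|s| < 1 ->
  (1 - s) ^+ 2 * (s * regular'' mu s + (n%:R / 2 + 1) * regular' mu s)
  + n%:R * (1 - s) * s * regular' mu s + mu * regular mu s = 0.
Proof.
move=> s1; set a := regular_coef mu.
have ga : radius_ge1 a := radius_ge1_regular_coef mu.
pose d1 := pseries_diffs a; pose d2 := pseries_diffs d1.
have g1 : radius_ge1 d1 by exact: radius_ge1_diffs.
have g2 : radius_ge1 d2 by exact: radius_ge1_diffs.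
pose x := coef_mulX d1; have gx : radius_ge1 x by exact: radius_ge1_shift.
pose c k := coef_mulX d2 k + (n%:R / 2 + 1) * d1 k.
have gZ := @radius_ge1Z R; have gD := @radius_ge1D R; have gS := @radius_ge1_shift R.
have gc : radius_ge1 c by exact: gD _ _ (gS _ g2) (gZ _ _ g1).
have cE : psum c s = s * regular'' mu s + (n%:R / 2 + 1) * regular' mu s.
  by rewrite psumD ?psum_shift ?psumZ//; [exact: gS | exact: gZ].
have dE : psum d1 s = regular' mu s by [].
have ck k : c k = - n%:R * @rmoment R n (- n%:R) (- mu) k
                  - mu * @rsum2 R n (- n%:R) (- mu) k.
  have H := rcoefS (n := n) (- n%:R) (- mu) k; rewrite mulNr in H.
  have -> : - n%:R * @rmoment R n (- n%:R) (- mu) k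
    - mu * @rsum2 R n (- n%:R) (- mu) k = a k.+1 * (k.+1%:R * (k%:R + @rindex R n)).
    by rewrite /a /regular_coef H divfK ?mulNr// gt_eqF// rden_gt0.
  rewrite /c /d2 /d1 /coef_mulX /pseries_diffs /rindex; case: k {H} => [|k]; first by ring.
  by rewrite -!natr1; ring.
(* the coefficients of the left-hand side of the equation *)
pose z k := c k + (-2 * coef_mulX c k + (coef_mulX (coef_mulX c) k +
   (n%:R * x k + (- n%:R * coef_mulX x k + mu * a k)))).
have z0 k : z k = 0.
  rewrite /z; case: k => [|[|k]] /=; rewrite ?ck.
  - by rewrite /rmoment /rsum2 /a /regular_coef /rcoef /=; ring.
  - rewrite rmomentS rsum2S rsumS /d1 /pseries_diffs /a /regular_coef.
    by rewrite /rmoment /rsum2 /rsum /=; ring.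
  - rewrite !rmomentS !rsum2S !rsumS /d1 /pseries_diffs /a /regular_coef.
    by rewrite -!natr1; ring.
have : psum z s = 0.
  have -> : psum z s = z 0%N by rewrite psum_head// => k; rewrite z0 mul0r.
  exact: z0.
have gxs := gS _ gx; have gcs := gS _ gc; have gcss := gS _ gcs.
have e1 := gZ mu _ ga; have e2 := gD _ _ (gZ (- n%:R) _ gxs) e1.
have e3 := gD _ _ (gZ n%:R _ gx) e2; have e4 := gD _ _ gcss e3.
have e5 := gD _ _ (gZ (-2) _ gcs) e4.
rewrite /z (psumD gc e5 s1) (psumD (gZ (-2) _ gcs) e4 s1) (psumD gcss e3 s1).
rewrite (psumD (gZ n%:R _ gx) e2 s1) (psumD (gZ (- n%:R) _ gxs) e1 s1).
rewrite !psumZ// !psum_shift// cE dE => <-.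
by rewrite /regular -/a; ring.
Qed.

(** In divergence form the equation is (p H')' = - mu p H/(s (1-s)^2) with p =
    s^(n/2+1) (1-s)^-n, so p H' decreases from its value 0 at the origin as
    long as H >= 0. *)
Lemma regular_nonincreasing mu S : 0 <= mu -> S < 1 ->
  (forall s, 0 <= s <= S -> 0 <= regular mu s) ->
  forall s t, 0 <= s -> s <= t -> t <= S -> regular mu t <= regular mu s.
Proof.
move=> mu0 S1 H0.
(* p H' as a function of y, where s = y^2: only integer powers of y and 1 -
   y^2 occur *)
pose q y := y ^+ n.+2 * ((1 - y ^+ 2)^-1) ^+ n * regular' mu (y ^+ 2).
pose q' y := - 2 * mu * y ^+ n.+1 * ((1 - y ^+ 2)^-1) ^+ n.+2 * regular mu (y ^+ 2).
have q'E (y : R) : 0 <= y -> y ^+ 2 <= S -> is_derive y 1 q (q' y).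
  move=> y0 yS; have y2 : 0 <= y ^+ 2 by exact: sqr_ge0.
  have s1 : -1 < y ^+ 2 < 1 by apply/andP; split; lra.
  have n1 : 1 - y ^+ 2 != 0 by rewrite subr_eq0 gt_eqF//; lra.
  have dsq : is_derive y 1 (fun y : R => y ^+ 2) (2 * y).
    by differentiate; rewrite expr1 mulr1.
  have dh := is_derive_compf dsq (is_derive_regular' mu s1).
  rewrite /q; differentiate => //.
  have ys1 : `|y ^+ 2| < 1 by rewrite ger0_norm//; lra.
  have := regular_ode mu ys1; rewrite /q' /=.
  have := natmul_pred_exp ((1 - y ^+ 2)^-1) n.
  set s := y ^+ 2; set g := (1 - s)^-1; set P := g ^+ n.-1.
  set h := regular mu s; set h' := regular' mu s; set h'' := regular'' mu s => PE ode.
  have gE : (1 - s) * g = 1 by rewrite divff.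
  have -> : g ^+ n.+2 = g ^+ n * g ^+ 2 by rewrite -addn2 exprD.
  set Q := g ^+ n in PE *.
  have -> : ((1 - s) ^+ 2)^-1 = g ^+ 2 by rewrite /g exprVn.
  have -> : y ^+ n.+2 = y ^+ n.+1 * y by rewrite exprSr.
  have E3 : mu * h * g ^+ 2 = - (s * h'' + (n%:R / 2 + 1) * h' + n%:R * s * h' * g).
    have -> : mu * h = - ((1 - s) ^+ 2 * (s * h'' + (n%:R / 2 + 1) * h')
       + n%:R * (1 - s) * s * h') by lra.
    by rewrite /g; field.
  have -> : -2 * mu * y ^+ n.+1 * (Q * g ^+ 2) * h =
    -2 * y ^+ n.+1 * Q * (mu * h * g ^+ 2) by ring.
  rewrite E3.
  have -> : n%:R * P * (- (0 - 2 * y) * g ^+ 2) = n%:R * Q * (2 * y * g).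
    by rewrite -PE; ring.
  by rewrite -!natr1 /s; field.
have h'0 u : 0 < u -> u <= S -> regular' mu u <= 0.
  move=> u0 uS; pose y := Num.sqrt u.
  have y2 : y ^+ 2 = u by rewrite sqr_sqrtr// ltW.
  have y0 : 0 < y by rewrite sqrtr_gt0.
  have : q y <= q 0.
    apply: (@nonincreasing_on _ q q' 0 y) => //; last exact: ltW.
      move=> t /andP[t0 ty]; apply: q'E => //.
      by apply: le_trans uS; rewrite -y2 lerXn2r ?nnegrE//; exact: ltW.
    move=> t /andP[t0 ty].
    have ts : t ^+ 2 <= S.
      by apply: le_trans uS; rewrite -y2 lerXn2r ?nnegrE ?(ltW y0) ?(ltW t0) ?(ltW ty).
    have t2 := sqr_ge0 t.
    rewrite /q' !mulNr oppr_le0; apply: mulr_ge0; last by apply: H0; rewrite t2.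
    apply: mulr_ge0; last by rewrite exprn_ge0// invr_ge0 subr_ge0; lra.
    by apply: mulr_ge0; [apply: mulr_ge0 | rewrite exprn_ge0// ltW].
  rewrite /q expr0n /= !mul0r y2 pmulr_rle0//.
  by rewrite mulr_gt0// exprn_gt0// invr_gt0 subr_gt0; lra.
move=> s t s0 st tS.
apply: (@nonincreasing_on _ (regular mu) (regular' mu) s t) => //.
  by move=> u /andP[u0 u1]; apply: is_derive_regular; apply/andP; split; lra.
by move=> u /andP[u0 u1]; apply: h'0; lra.
Qed.

Lemma regular_lipschitz (L S : R) : 1 <= L -> 0 <= S < 1 -> exists2 K, 0 <= K &
  forall mu nu s, `|mu| <= L -> `|nu| <= L -> 0 <= s <= S ->
    `|regular mu s - regular nu s| <= `|mu - nu| * K.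
Proof.
move=> L1 /andP[S0 S1]; pose b := @rcoef R n n%:R L.
have gb : radius_ge1 b by apply: radius_ge1_rcoef => //; lra.
pose e := coef_mulX (pseries_diffs b).
have ge : radius_ge1 e by apply/radius_ge1_shift/radius_ge1_diffs.
have eE k : e k = k%:R * b k by case: k => [|k]; rewrite /e /= ?mul0r.
have e0 k : 0 <= e k.
  by rewrite eE mulr_ge0//; have [] := @rstate_ge0 R n n%:R L k (ler0n _ _); lra.
exists (psum e S).
  apply: le_trans (normr_ge0 (psum (fun=> 0) 0)) _.
  by apply: psum_le => //; [rewrite lexx | move=> k; rewrite normr0].
move=> mu nu s muL nuL /andP[s0 sS].
have s1 : `|s| < 1 by rewrite ger0_norm//; lra.
have gmu := radius_ge1_regular_coef mu; have gnu := radius_ge1_regular_coef nu.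
have -> : regular mu s - regular nu s = psum
    (fun k => regular_coef mu k + -1 * regular_coef nu k) s.
  by rewrite psumD ?psumZ ?mulN1r//; exact: radius_ge1Z.
have nS : `|S| < 1 by rewrite ger0_norm.
rewrite -(psumZ _ ge nS); apply: psum_le => //; first exact: radius_ge1Z.
  by rewrite s0.
move=> k; rewrite eE mulN1r.
have [] // := @rstate_lipschitz R n (- n%:R) (- mu) (- nu) n%:R L k.
- by rewrite normrN normr_nat.
- by rewrite normrN.
- by rewrite normrN.
- by move=> H _ _ _; apply: le_trans H _; rewrite -opprD normrN.
Qed.

(** Let m be the supremum of the mu in [0, mu1] for which the solution is
    nonnegative on [0, S]; by the Lipschitz bound this is a maximum. Since the
    solution for m is nonincreasing, a positive value at S would bound it away
    from 0 on the whole interval, and m could be increased (m = mu1 being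
    excluded by s0). *)
Lemma regular_zero_exists (mu1 S : R) : 0 <= mu1 -> 0 <= S < 1 ->
  (exists2 s0, 0 <= s0 <= S & regular mu1 s0 <= 0) ->
  exists2 mu, 0 <= mu <= mu1 & regular mu S = 0.
Proof.
move=> mu10 /andP[S0 S1] [s0 /andP[s00 s0S] hs0].
pose L := Num.max mu1 1.
have L1 : 1 <= L by rewrite le_max lexx orbT.
have muL mu : 0 <= mu <= mu1 -> `|mu| <= L.
  by move=> /andP[m0 m1]; rewrite ger0_norm// le_max m1.
have S01 : 0 <= S < 1 by rewrite S0.
have [K K0 HK] := regular_lipschitz L1 S01.
(* 0 belongs to A because the solution for mu = 0 is constant *)
pose A := [set mu : R | 0 <= mu <= mu1 /\ forall s, 0 <= s <= S -> 0 <= regular mu s].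
have A0 : A 0.
  by split; [rewrite lexx | move=> s _; rewrite regular_mu0].
have Aub : has_ubound A by exists mu1 => mu [/andP[]].
pose m := sup A.
have m0 : 0 <= m by apply: ub_le_sup.
have m1 : m <= mu1 by apply: ge_sup; [exists 0 | move=> mu [/andP[]]].
have m01 : 0 <= m <= mu1 by rewrite m0.
have Am s : 0 <= s <= S -> 0 <= regular m s.
  move=> sS; rewrite leNgt; apply/negP => hneg.
  pose d := - regular m s / (K + 1).
  have d0 : 0 < d by rewrite divr_gt0 ?oppr_gt0//; lra.
  have [|mu [mu01 Hmu] dmu] := @sup_adherent R A d d0.
    by split=> //; exists 0.
  have mum : mu <= m by apply: ub_le_sup.
  have := HK m mu s (muL _ m01) (muL _ mu01) sS.
  have := Hmu s sS => hmu; rewrite ler_distl => /andP[H1 _].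
  have dE : d * (K + 1) = - regular m s by rewrite /d divfK// gt_eqF//; lra.
  have : `|m - mu| <= d by rewrite ger0_norm; rewrite -/m in dmu; lra.
  move=> Hd; have := normr_ge0 (m - mu); nra.
exists m => //; apply/eqP; rewrite eq_le Am ?S0 ?lexx// andbT leNgt; apply/negP => hpos.
have dec := regular_nonincreasing m0 S1 Am.
have [mE|mne] := eqVneq m mu1.
  have := dec s0 S s00 s0S (lexx _); rewrite mE => H.
  by move: hpos; rewrite mE => hpos; lra.
have mlt : m < mu1 by rewrite lt_neqAle mne.
(* a step that keeps the solution nonnegative *)
pose d := Num.min (mu1 - m) (regular m S / (K + 1)).
have d0 : 0 < d by rewrite lt_min subr_gt0 mlt divr_gt0//; lra.
have d1 : d <= mu1 - m by rewrite ge_min lexx.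
have d2 : d * (K + 1) <= regular m S.
  by rewrite -ler_pdivlMr; [rewrite ge_min lexx orbT | lra].
have Amd : A (m + d).
  have md : 0 <= m + d <= mu1 by apply/andP; split; lra.
  split=> // s /andP[s1 s2]; have sS : 0 <= s <= S by rewrite s1.
  have := HK (m + d) m s (muL _ md) (muL _ m01) sS.
  rewrite addrAC subrr add0r (gtr0_norm d0) ler_distl => /andP[H1 _].
  by have := dec s S s1 s2 (lexx _); nra.
have := ub_le_sup Aub Amd; rewrite -/m; lra.
Qed.

End RadialSolution.

(** * Dirichlet eigenvalues of a Euclidean ball *)

Section SecondEigenvalue.
Context {R : realType} {n : nat}.
Implicit Types (s t mu S : R).

(** The factor k of the eigenfunctions x_i k(|x|^2). *)
Definition profile mu s := regular (n := n) mu s / (1 - s).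
Definition profile' mu s := regular' (n := n) mu s / (1 - s)
  + regular (n := n) mu s / (1 - s) ^+ 2.
Definition profile'' mu s := regular'' (n := n) mu s / (1 - s)
  + 2 * regular' (n := n) mu s / (1 - s) ^+ 2 + 2 * regular (n := n) mu s / (1 - s) ^+ 3.

Lemma is_derive_profile mu s : -1 < s < 1 -> is_derive s 1 (profile mu) (profile' mu s).
Proof.
move=> s1; have s0 : 1 - s != 0.
  by have /andP[_ s2] := s1; rewrite subr_eq0 gt_eqF.
have dh := is_derive_regular (n := n) mu s1; rewrite /profile; differentiate => //.
by rewrite /profile'; field.
Qed.

Lemma is_derive_profile' mu s : -1 < s < 1 -> is_derive s 1 (profile' mu) (profile'' mu s).
Proof.
move=> s1; have s0 : 1 - s != 0.
  by have /andP[_ s2] := s1; rewrite subr_eq0 gt_eqF.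
have dh := is_derive_regular (n := n) mu s1; have dh' := is_derive_regular' (n := n) mu s1.
rewrite /profile'; differentiate => //; first by rewrite expf_neq0.
by rewrite /profile'' /=; field.
Qed.

Lemma continuous_profile'' mu s : -1 < s < 1 -> {for s, continuous (profile'' mu)}.
Proof.
move=> s1; have s0 : 1 - s != 0.
  by have /andP[_ s2] := s1; rewrite subr_eq0 gt_eqF.
have cosh := is_derive_continuous (is_derive_regular (n := n) mu s1).
have ch' := is_derive_continuous (is_derive_regular' (n := n) mu s1).
have ch'' := @continuous_regular'' R n mu s s1.
have cV k : {for s, continuous (fun s : R => ((1 - s) ^+ k)^-1)}.
  have [d dd] : exists d : R, is_derive s 1 (fun s : R => ((1 - s) ^+ k)^-1) d.
    by eexists; differentiate_rec; rewrite expf_neq0.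
  exact: is_derive_continuous dd.
have c2 : {for s, continuous (fun _ : R => 2 : R)} by exact: cst_continuous.
have c1 := continuous_atM ch'' (cV 1%N).
have c3 := continuous_atM (continuous_atM c2 ch') (cV 2%N).
have c4 := continuous_atM (continuous_atM c2 cosh) (cV 3%N).
exact: (continuous_atD (continuous_atD c1 c3) c4).
Qed.

Lemma profile_ode mu s : 0 <= s < 1 ->
  (1 - s) ^+ 2 * (s * profile'' mu s + (n%:R / 2 + 1) * profile' mu s)
  + (n%:R - 2) * (1 - s) * (profile mu s / 2 + s * profile' mu s)
  + (mu - n%:R) * profile mu s = 0.
Proof.
move=> /andP[s0 s1]; have sn : `|s| < 1 by rewrite ger0_norm.
have s10 : 1 - s != 0 by rewrite subr_eq0 gt_eqF.
have ode := regular_ode (n := n) mu sn.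
rewrite -[RHS](mul0r (1 - s)^-1) -{}ode /profile /profile' /profile''.
by field.
Qed.

(** Multiplying the same radial profile by two different coordinates gives the
    second eigenvalue at least multiplicity two; this is where n >= 2 enters.
    *)
Lemma two_eigenfunctions mu S : (2 <= n)%N -> 0 < S < 1 -> regular (n := n) mu S = 0 ->
  at_least_eigenvalues (@hyp_metric R n) (euclidean_ball S) 2 (mu - n%:R).
Proof.
move=> n2 /andP[S0 S1] hS.
exists (fun=> mu - n%:R), (fun j => coord_radial (profile mu) (widen_ord n2 j)).
split=> // [j|a az j].
  apply: (coord_radial_eigenfunction _ (@is_derive_profile mu)
    (@is_derive_profile' mu) (@continuous_profile'' mu)) => //.
    move=> s /andP[s0 sS]; apply: profile_ode; apply/andP; split; lra.
  by rewrite /profile hS mul0r.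
(* a radius at which the profile does not vanish: it equals 1 at the origin *)
have [s /andP[s0 sS] ks] : exists2 s, 0 < s < S & profile mu s != 0.
  have h0 : -1 < (0 : R) < 1 by apply/andP; split; lra.
  have cosh := is_derive_continuous (is_derive_regular (n := n) mu h0).
  rewrite /prop_for /continuous_at regular_at0 in cosh.
  have := cvgr_gt 1 cosh; move=> /(_ _ 0 ltr01) /nbhs_ballP [e /= e0 He].
  pose s := Num.min (e / 2) (S / 2).
  have s0 : 0 < s by rewrite lt_min !divr_gt0.
  have se : s <= e / 2 by rewrite ge_min lexx.
  have sS : s <= S / 2 by rewrite ge_min lexx orbT.
  exists s; first by apply/andP; split; lra.
  have hs : 0 < regular (n := n) mu s.
    by apply: He; rewrite /ball /= sub0r normrN gtr0_norm//; lra.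
  by rewrite /profile mulf_neq0 ?gt_eqF// invr_gt0; lra.
pose x : 'rV[R]_n := Num.sqrt s *: 'e_(widen_ord n2 j).
have ex i : x 0 (widen_ord n2 i) = Num.sqrt s * (i == j)%:R.
  by rewrite !mxE eqxx -val_eqE.
have sx : sqnorm x = s.
  rewrite sqnormZ sqr_sqrtr; last exact: ltW.
  rewrite /sqnorm (bigD1 (widen_ord n2 j))//= big1 => [|i ij].
    by rewrite mxE !eqxx expr1n addr0 mulr1.
  by rewrite mxE (negbTE ij) andbF expr0n.
have := az x; rewrite /euclidean_ball /= sx => /(_ sS).
rewrite (bigD1 j)//= big1 => [|i ij]; last first.
  by rewrite /coord_radial ex (negbTE ij) mulr0 mul0r mulr0.
rewrite addr0 /coord_radial ex eqxx mulr1 sx => /eqP.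
rewrite mulf_eq0 => /orP[/eqP//|].
by rewrite mulf_eq0 (negbTE ks) orbF sqrtr_eq0 leNgt s0.
Qed.

Lemma at_least_two_one (B : set 'rV[R]_n) (g : 'rV[R]_n -> 'M[R]_n) t :
  at_least_eigenvalues g B 2 t -> at_least_eigenvalues g B 1 t.
Proof.
move=> [m [u [mt ue li]]].
exists (fun=> m ord0), (fun=> u ord0); split=> // a az j.
have := li (fun i : 'I_2 => if i == ord0 then a j else 0).
move=> /(_ _ ord0) /=; apply=> x Bx; rewrite big_ord_recl big_ord1 /= mul0r addr0.
by have := az x Bx; rewrite big_ord1 (ord1 j).
Qed.

Lemma at_least_one_eigenfunction (B : set 'rV[R]_n) (g : 'rV[R]_n -> 'M[R]_n) t :
  at_least_eigenvalues g B 1 t ->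
  exists mu u, [/\ mu <= t, dirichlet_eigenspace g B mu u & exists2 x, B x & u x != 0].
Proof.
move=> [m [u [mt ue li]]]; exists (m ord0), (u ord0); split=> //.
apply: contrapT => nx; have := li (fun=> 1).
have H x : B x -> \sum_(j < 1) 1 * u j x = 0.
  move=> Bx; rewrite big_ord1 mul1r; apply/eqP; apply: contrapT => /negP ux.
  by apply: nx; exists x.
by move=> /(_ H ord0) /eqP; rewrite oner_eq0.
Qed.

Definition barta_bound (S m : R) := forall t,
  at_least_eigenvalues (@hyp_metric R n) (euclidean_ball S) 1 t -> m <= t.

Lemma barta_bound_radial S m (f f' f'' : R -> R) : S < 1 ->
  (forall s : R, -1 < s < 1 -> is_derive s 1 f (f' s)) ->
  (forall s : R, -1 < s < 1 -> is_derive s 1 f' (f'' s)) ->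
  (forall s, 0 <= s <= S -> 0 < f s) ->
  (forall s, 0 <= s <= S ->
     (1 - s) ^+ 2 * (s * f'' s + n%:R / 2 * f' s) + (n%:R - 2) * (1 - s) * s * f' s
       <= - m * f s) ->
  barta_bound S m.
Proof.
move=> S1 df df' f0 fL t /at_least_one_eigenfunction[mu [u [mut ue [x Bx ux]]]].
exact: le_trans (barta_eigenvalue_ge S1 df df' f0 fL ue Bx ux) mut.
Qed.

Lemma barta_bound0 S : S < 1 -> barta_bound S 0.
Proof.
move=> S1; apply: (@barta_bound_radial S 0 (fun=> 1) (fun=> 0) (fun=> 0)) => //.
- by move=> s _; rewrite !mulr0 !addr0 oppr0 mul0r mulr0.
Qed.

(** The eigenvalues are infima of sets of reals, which give the expected
    values only for sets that are nonempty and bounded below; the two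
    eigenfunctions provide the former and the constant supersolution the
    latter. *)
Lemma eigenvalue_bounds S mu : (2 <= n)%N -> 0 < S < 1 -> regular (n := n) mu S = 0 ->
  let E k := dirichlet_eigenvalue (@hyp_metric R n) (euclidean_ball S) k in
  [/\ forall m, barta_bound S m -> m <= E 1%N, E 1%N <= E 2%N & E 2%N <= mu - n%:R].
Proof.
move=> n2 /[dup] S01 /andP[S0 S1] hS E.
have two := two_eigenfunctions n2 S01 hS.
have lb1 : has_lbound [set t | at_least_eigenvalues (@hyp_metric R n) (euclidean_ball S) 1 t].
  by exists 0 => t; exact: barta_bound0.
split.
- move=> m bm; apply: lb_le_inf; last by move=> t; exact: bm.
  by exists (mu - n%:R); exact: at_least_two_one.
- apply: lb_le_inf; first by exists (mu - n%:R).
  by move=> t /at_least_two_one t1; exact: ge_inf.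
- apply: ge_inf => //; exists 0 => t /at_least_two_one; exact: barta_bound0.
Qed.
End SecondEigenvalue.

(** * Comparison in the hyperbolic radius *)

Section Hyperbolic.
Context {R : realType}.
Implicit Types (r k t : R).

Definition sinh r := (expR r - expR (- r)) / 2.
Definition cosh r := (expR r + expR (- r)) / 2.

Lemma is_derive_sinh r : is_derive r 1 sinh (cosh r).
Proof. by rewrite /sinh; differentiate; rewrite /cosh; ring. Qed.

Lemma is_derive_cosh r : is_derive r 1 cosh (sinh r).
Proof. by rewrite /cosh; differentiate; rewrite /sinh; ring. Qed.

Lemma cosh_sqr r : cosh r ^+ 2 = 1 + sinh r ^+ 2.
Proof.
rewrite /cosh /sinh; have E := expRxMexpNx_1 r.
set a := expR r in E *; set b := expR (- r) in E *.
have : ((a + b) / 2) ^+ 2 - ((a - b) / 2) ^+ 2 = 1.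
  by transitivity (a * b); [field | exact: E].
lra.
Qed.

Lemma sinh_gt0 r : 0 < r -> 0 < sinh r.
Proof. by move=> r0; rewrite /sinh divr_gt0// subr_gt0 ltr_expR; lra. Qed.

Lemma cosh_gt0 r : 0 < cosh r.
Proof. by rewrite /cosh divr_gt0// addr_gt0 ?expR_gt0. Qed.

Lemma coth_ge1 r : 0 < r -> 1 <= cosh r / sinh r.
Proof.
move=> r0; rewrite ler_pdivlMr ?sinh_gt0// mul1r /cosh /sinh.
have := expR_gt0 (- r); lra.
Qed.

Lemma sinh_ge r : 0 <= r -> r <= sinh r.
Proof.
move=> r0.
have := @nonincreasing_on R (fun t => t - sinh t) (fun t => 1 - cosh t) 0 r.
move=> /(_ _ _ 0 r (lexx _) r0 (lexx _)).
rewrite /= /sinh oppr0 !subrr mul0r subr0 subr_le0; apply.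
- by move=> t _; have d := is_derive_sinh t; differentiate.
- move=> t _; rewrite subr_le0.
  by have := cosh_sqr t; have := cosh_gt0 t; have := sqr_ge0 (sinh t); nra.
Qed.

(** The potential at rho is smaller by a factor exp(-2a) than the one at rho -
    a. *)
Lemma sinh_shift (a t : R) : 0 <= a -> 0 <= t -> expR a * sinh t <= sinh (t + a).
Proof.
move=> a0 t0; rewrite /sinh mulrA mulrBr -!expRD [a + t]addrC.
rewrite ler_pM2r ?invr_gt0// lerD2l lerN2 ler_expR; lra.
Qed.

Lemma one_sub_tanh_half_sqr r : 1 - tanh_half r ^+ 2 = 4 * expR r / (expR r + 1) ^+ 2.
Proof. by rewrite /tanh_half; field; have := expR_gt0 r => ?; rewrite gt_eqF//; lra. Qed.

Lemma is_derive_tanh_half r : is_derive r 1 (@tanh_half R) ((1 - tanh_half r ^+ 2) / 2).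
Proof.
have E0 : expR r + 1 != 0 by have := expR_gt0 r => ?; rewrite gt_eqF//; lra.
by rewrite one_sub_tanh_half_sqr /tanh_half; differentiate => //; field.
Qed.

Lemma coth_mul_tanh_half r : 0 < r -> cosh r / sinh r * tanh_half r = (1 + tanh_half r ^+ 2) / 2.
Proof.
move=> r0; rewrite /cosh /sinh expRN /tanh_half; have E1 : 1 < expR r by rewrite expR_gt1.
have E0 := expR_gt0 r; field.
by rewrite !gt_eqF//; nra.
Qed.

Lemma tanh_half_le r t : r <= t -> tanh_half r <= tanh_half t.
Proof.
rewrite -ler_expR => rt; have r0 := expR_gt0 r; have t0 := expR_gt0 t.
rewrite /tanh_half ler_pdivrMr; last by lra.
by rewrite mulrAC ler_pdivlMr; nra.
Qed.

(** The form of k <= tan k that survives beyond pi/2. *)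
Lemma k_cos_le_sin k : 0 <= k <= pi -> k * cos k <= sin k.
Proof.
move=> /andP[k0 kpi].
have := @nonincreasing_on R (fun t => t * cos t - sin t) (fun t => - (t * sin t)) 0 k.
move=> /(_ _ _ 0 k (lexx _) k0 (lexx _)).
rewrite /= sin0 mul0r subrr subr_le0; apply.
- by move=> t _; differentiate; ring.
- move=> t /andP[t0 tk]; rewrite oppr_le0 mulr_ge0 ?(ltW t0)// sin_ge0_pi//.
  by apply/andP; split; lra.
Qed.
End Hyperbolic.

Section Comparison.
Context {R : realType} {n : nat}.
Implicit Types (r k t : R).

(** The exponent of sinh that removes the first-order term of the radial
    equation in dimension n + 2. *)
Definition liouville_exp : R := (n%:R + 1) / 2.
Definition potential r := liouville_exp * (liouville_exp - 1) / sinh r ^+ 2.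
Definition liouville k2 r :=
  expR (liouville_exp * ln (sinh r)) *
  regular (n := n) (liouville_exp ^+ 2 + k2) (tanh_half r ^+ 2).
Definition liouville' k2 r :=
  expR (liouville_exp * ln (sinh r)) *
  (regular' (n := n) (liouville_exp ^+ 2 + k2) (tanh_half r ^+ 2) *
     (tanh_half r * (1 - tanh_half r ^+ 2))
   + liouville_exp * (cosh r / sinh r) *
     regular (n := n) (liouville_exp ^+ 2 + k2) (tanh_half r ^+ 2)).

Lemma tanh_half_sqr_itv r : 0 < r -> -1 < tanh_half r ^+ 2 < 1.
Proof.
move=> r0; have T0 := tanh_half_gt0 r0; have T1 := tanh_half_lt1 r.
by apply/andP; split; nra.
Qed.

Lemma is_derive_liouville_factor r : 0 < r ->
  is_derive r 1 (fun r => expR (liouville_exp * ln (sinh r)))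
    (expR (liouville_exp * ln (sinh r)) * (liouville_exp * (cosh r / sinh r))).
Proof.
move=> r0; have ds := is_derive_sinh r; have s0 := sinh_gt0 r0.
by differentiate => //; ring.
Qed.

Lemma is_derive_liouville k2 r : 0 < r -> is_derive r 1 (liouville k2) (liouville' k2 r).
Proof.
move=> r0; have s1 := tanh_half_sqr_itv r0; have dm := is_derive_liouville_factor r0.
have dT := is_derive_tanh_half r.
have dT2 : is_derive r 1 (fun r : R => tanh_half r ^+ 2) (tanh_half r * (1 - tanh_half r ^+ 2)).
  by differentiate; rewrite /=; field.
have dh := is_derive_compf dT2 (is_derive_regular (n := n) (liouville_exp ^+ 2 + k2) s1).
by rewrite /liouville; differentiate; rewrite /liouville'; ring.
Qed.

(** Liouville's transformation: y = sinh^a H(tanh^2(r/2)) with 2a = n+1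
    satisfies y'' = (V - k^2) y when mu = a^2 + k^2. *)
Lemma is_derive_liouville' k2 r : 0 < r -> is_derive r 1 (liouville' k2)
  ((potential r - k2) * liouville k2 r).
Proof.
move=> r0; have s1 := tanh_half_sqr_itv r0; have dm := is_derive_liouville_factor r0.
have dT := is_derive_tanh_half r; have T0 := tanh_half_gt0 r0; have sh0 := sinh_gt0 r0.
have dT2 : is_derive r 1 (fun r : R => tanh_half r ^+ 2) (tanh_half r * (1 - tanh_half r ^+ 2)).
  by differentiate; rewrite /=; field.
have dh := is_derive_compf dT2 (is_derive_regular (n := n) (liouville_exp ^+ 2 + k2) s1).
have dh' := is_derive_compf dT2 (is_derive_regular' (n := n) (liouville_exp ^+ 2 + k2) s1).
have ds := is_derive_sinh r; have dc := is_derive_cosh r.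
have sn : `|tanh_half r ^+ 2| < 1 by rewrite ltr_norml.
have ode := regular_ode (n := n) (liouville_exp ^+ 2 + k2) sn.
have ct := coth_mul_tanh_half r0; have c2 := cosh_sqr r.
rewrite /liouville'; differentiate; first by rewrite gt_eqF.
rewrite /liouville /potential.
set T := tanh_half r in ode ct *; set s := T ^+ 2 in ode ct *.
set h := regular _ s in ode *; set h' := regular' _ s in ode *; set h'' := regular'' _ s in ode *.
set m := expR _; set a := liouville_exp in ode *.
have shn0 : sinh r != 0 by rewrite gt_eqF.
have -> : sinh r / sinh r + cosh r * (- cosh r / sinh r ^+ 2) = 1 - (cosh r / sinh r) ^+ 2.
  by field.
have -> : a * (a - 1) / sinh r ^+ 2 = a * (a - 1) * ((cosh r / sinh r) ^+ 2 - 1).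
  have -> : (cosh r / sinh r) ^+ 2 - 1 = (cosh r ^+ 2 - sinh r ^+ 2) / sinh r ^+ 2 by field.
  by rewrite c2 addrK mul1r.
set X := cosh r / sinh r in ct *.
have nE : n%:R = 2 * a - 1 :> R by rewrite /a /liouville_exp; field.
rewrite nE in ode.
apply/eqP; rewrite -subr_eq0; apply/eqP.
transitivity (m * ((1 - s) ^+ 2 * (s * h'' + ((2 * a - 1) / 2 + 1) * h')
    + (2 * a - 1) * (1 - s) * s * h' + (a ^+ 2 + k2) * h)
  + 2 * a * m * h' * (1 - s) * (X * T - (1 + s) / 2)); first by rewrite /s; field.
by rewrite ode ct subrr !mulr0 addr0.
Qed.

(** If the solution were positive on [p, q], so would be its Liouville
    transform y; at an interior maximum of z/y, with value M > 0, the function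
    z - M y has a maximum equal to 0 and so z'' <= M y'' = (V - k^2) z there,
    against the strict inequality assumed for z. *)
Lemma regular_nonpos_of_subsolution k2 (z z' z'' : R -> R) (p q c : R) : 0 < p -> p <= c <= q ->
  (forall t : R, p <= t <= q -> is_derive t 1 z (z' t)) ->
  (forall t : R, p <= t <= q -> is_derive t 1 z' (z'' t)) ->
  z p <= 0 -> z q <= 0 -> 0 < z c ->
  (forall t, p <= t <= q -> 0 < z t -> 0 < z'' t + (k2 - potential t) * z t) ->
  exists2 r, p <= r <= q & regular (n := n) (liouville_exp ^+ 2 + k2) (tanh_half r ^+ 2) <= 0.
Proof.
move=> p0 /andP[pc cq] dz dz' zp zq zc zineq; apply: contrapT => nex.
have y0 r : p <= r <= q -> 0 < liouville k2 r.
  move=> rpq; rewrite /liouville mulr_gt0 ?expR_gt0// ltNge; apply/negP => h.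
  by apply: nex; exists r.
have pq : p <= q by exact: le_trans cq.
have cw : {within `[p, q], continuous (fun t => z t / liouville k2 t)}.
  apply: derivable_within_continuous => t; rewrite in_itv /= => tpq.
  have dzt := dz t tpq; have yt := y0 t tpq.
  have dy : is_derive t 1 (liouville k2) (liouville' k2 t).
    by apply: is_derive_liouville; move/andP: tpq => []; lra.
  have [d dd] : exists d : R, is_derive t 1 (fun t : R => z t / liouville k2 t) d.
    by eexists; differentiate_rec; rewrite gt_eqF.
  exact: ex_derive.
have [d] := EVT_max pq cw; rewrite in_itv /= => dpq maxd.
set M := z d / liouville k2 d in maxd.
have yd := y0 d dpq.
have M0 : 0 < M.
  have := maxd c; rewrite in_itv /= pc cq => /(_ isT); apply: lt_le_trans.
  by rewrite divr_gt0// y0// pc.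
have zd : z d = M * liouville k2 d by rewrite /M divfK// gt_eqF.
have zd0 : 0 < z d by rewrite zd mulr_gt0.
have /andP[pd dq] := dpq.
have pd' : p < d by rewrite lt_neqAle pd andbT; apply: contraTneq zd0 => <-; rewrite -leNgt.
have dq' : d < q by rewrite lt_neqAle dq andbT; apply: contraTneq zd0 => ->; rewrite -leNgt.
pose e := Num.min (d - p) (q - d).
have e0 : 0 < e by rewrite lt_min !subr_gt0 pd'.
have ein t : `|t - d| < e -> p <= t <= q.
  by rewrite lt_min !ltr_norml => /andP[/andP[? ?] /andP[? ?]]; apply/andP; split; lra.
have dg t : `|t - d| < e -> is_derive t 1 (fun t => z t - M * liouville k2 t)
    (z' t - M * liouville' k2 t).
  move=> /ein tpq; have dzt := dz t tpq.
  have dy : is_derive t 1 (liouville k2) (liouville' k2 t).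
    by apply: is_derive_liouville; move/andP: tpq => []; lra.
  by differentiate; rewrite mul0r add0r.
have dg' : is_derive d 1 (fun t => z' t - M * liouville' k2 t)
    (z'' d - M * ((potential d - k2) * liouville k2 d)).
  have dzt := dz' d dpq; have dy := is_derive_liouville' k2 (lt_trans p0 pd').
  by differentiate; rewrite mul0r add0r.
have [|_] := local_max_test e0 dg dg'.
  move=> t /ein tpq; rewrite zd subrr subr_le0 -ler_pdivrMr ?y0//.
  by apply: maxd; rewrite in_itv.
have := zineq d dpq zd0; rewrite zd; nra.
Qed.
End Comparison.

(** * Bounds for both eigenvalues *)

Section SpectralBounds.
Context {R : realType} {n : nat}.
Hypothesis n2 : (2 <= n)%N.
Implicit Types (r k t : R).

Local Notation a' := (@liouville_exp R n).
Local Notation nu := (a' * (a' - 1)).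

Let n_ge2 : 2 <= n%:R :> R.
Proof. by rewrite ler_nat. Qed.

(** On [r/2, r] the potential is at most a constant over r^2, so a sine of
    half-period r/2 is a subsolution if k^2 is a large enough multiple of
    1/r^2. *)
Lemma regular_nonpos_short r : 0 < r ->
  exists2 t, 0 < t <= r &
    regular (n := n) (a' ^+ 2 + (4 * pi ^+ 2 + 4 * nu + 1) / r ^+ 2) (tanh_half t ^+ 2) <= 0.
Proof.
move=> r0; pose w := 2 * pi / r; have pi0 := pi_gt0 R.
have w0 : 0 < w by rewrite /w divr_gt0// mulr_gt0.
pose z (t : R) := sin (w * (t - r / 2)).
pose z' (t : R) := w * cos (w * (t - r / 2)).
pose z'' (t : R) := - w ^+ 2 * sin (w * (t - r / 2)).
set k2 := (4 * pi ^+ 2 + 4 * nu + 1) / r ^+ 2.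
have k2E : k2 = w ^+ 2 + 4 * nu / r ^+ 2 + r^-1 ^+ 2.
  by rewrite /k2 /w; field; rewrite gt_eqF.
have nu0 : 0 <= nu by rewrite /liouville_exp; have := n_ge2; nra.
have wr (c : R) : w * (r * c - r / 2) = 2 * pi * (c - 1 / 2).
  by rewrite /w; field; rewrite gt_eqF.
have [||||||||t /andP[t1 t2] ht] :=
    @regular_nonpos_of_subsolution R n k2 z z' z'' (r / 2) r (r * (3 / 4)).
- by rewrite divr_gt0.
- by apply/andP; split; lra.
- by move=> t _; rewrite /z; differentiate; rewrite /z'; ring.
- by move=> t _; rewrite /z'; differentiate; rewrite /z''; ring.
- by rewrite /z subrr mulr0 sin0.
- rewrite /z -[X in X - _]mulr1 wr; have -> : 2 * pi * (1 - 1 / 2) = pi :> R by field.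
  by rewrite sinpi.
- rewrite /z wr; have -> : 2 * pi * (3 / 4 - 1 / 2) = pi / 2 :> R by field.
  by rewrite sin_pihalf.
- move=> t /andP[t1 t2] zt; rewrite /z'' -/(z t).
  have t0 : 0 < t by lra.
  have shr : r / 2 <= sinh t by apply: le_trans t1 _; apply: sinh_ge; exact: ltW.
  have V : potential (n := n) t <= 4 * nu / r ^+ 2.
    rewrite /potential ler_pdivrMr ?exprn_gt0 ?sinh_gt0// [leRHS]mulrAC ler_pdivlMr ?exprn_gt0//.
    have : r ^+ 2 <= 4 * sinh t ^+ 2 by nra.
    by move: nu0; set N := nu; nra.
  rewrite -mulrDl mulr_gt0// k2E.
  have : 0 < r^-1 ^+ 2 by rewrite exprn_gt0// invr_gt0.
  lra.
by exists t => //; apply/andP; split; lra.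
Qed.

(** The function coth t sin(k(t-1)) - k cos(k(t-1)) of t = rho - n solves z''
    + (k^2 - 2/sinh^2 t) z = 0, and the potential at rho is below 2/sinh^2 t.
    The function is negative at t = 1, where the sine vanishes, positive at t
    = 1 + pi/k, and nonpositive at t = 2 + pi/k because k cos k <= sin k and
    coth >= 1. With k = pi/(r-n-2) the last point is rho = r. *)
Lemma regular_nonpos_long r : 2 * (n%:R + 2) <= r ->
  exists2 t, 0 < t <= r &
    regular (n := n) (a' ^+ 2 + (pi / (r - n%:R - 2)) ^+ 2) (tanh_half t ^+ 2) <= 0.
Proof.
move=> rn; have nn := n_ge2; have pi0 := pi_gt0 R.
set k := pi / (r - n%:R - 2).
have d0 : 0 < r - n%:R - 2 by lra.
have k0 : 0 < k by rewrite divr_gt0.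
have kE : k * (r - n%:R - 2) = pi by rewrite /k divfK// gt_eqF.
have kpi : k <= pi by rewrite -kE; nra.
pose th (t : R) := k * (t - n%:R - 1).
pose C (t : R) := cosh (t - n%:R) / sinh (t - n%:R).
pose z (t : R) := C t * sin (th t) - k * cos (th t).
pose z' (t : R) := - (sinh (t - n%:R) ^+ 2)^-1 * sin (th t) + C t * k * cos (th t)
  + k ^+ 2 * sin (th t).
pose z'' (t : R) := (2 / sinh (t - n%:R) ^+ 2 - k ^+ 2) * z t.
have tn (t : R) : n%:R + 1 <= t <= r -> 0 < t - n%:R by move=> /andP[]; lra.
have dsh (t : R) : is_derive t 1 (fun t : R => sinh (t - n%:R)) (cosh (t - n%:R)).
  have d1 : is_derive t 1 (fun t : R => t - n%:R) 1 by differentiate; ring.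
  by apply: (is_derive_val (is_derive_compf d1 (is_derive_sinh _))); rewrite mulr1.
have dch (t : R) : is_derive t 1 (fun t : R => cosh (t - n%:R)) (sinh (t - n%:R)).
  have d1 : is_derive t 1 (fun t : R => t - n%:R) 1 by differentiate; ring.
  by apply: (is_derive_val (is_derive_compf d1 (is_derive_cosh _))); rewrite mulr1.
have dth (t : R) : is_derive t 1 th k by rewrite /th; differentiate; ring.
have dC (t : R) : n%:R + 1 <= t <= r ->
    is_derive t 1 C (- (sinh (t - n%:R) ^+ 2)^-1).
  move=> /tn t0; have s0 : sinh (t - n%:R) != 0 by rewrite gt_eqF// sinh_gt0.
  have d1 := dsh t; have d2 := dch t; rewrite /C; differentiate => //.
  transitivity ((sinh (t - n%:R) ^+ 2 - cosh (t - n%:R) ^+ 2) / sinh (t - n%:R) ^+ 2).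
    by field.
  by rewrite cosh_sqr; field.
have [||||||||t /andP[t1 t2] ht] :=
    @regular_nonpos_of_subsolution R n (k ^+ 2) z z' z'' (n%:R + 1) r (r - 1).
- by lra.
- by apply/andP; split; lra.
- move=> t tr; have d1 := dC t tr; have d2 := dth t.
  by rewrite /z; differentiate; rewrite /z'; ring.
- move=> t tr; have d1 := dC t tr; have d2 := dth t; have d3 := dsh t.
  have s0 : sinh (t - n%:R) != 0 by rewrite gt_eqF// sinh_gt0// tn.
  rewrite /z'; differentiate; first by rewrite expf_neq0.
  by rewrite /z'' /z /C /=; field.
- rewrite /z; have -> : th (n%:R + 1) = 0 by rewrite /th; ring.
  by rewrite sin0 cos0 mulr0 mulr1 sub0r oppr_le0 ltW.
- rewrite /z; have -> : th r = k + pi by rewrite /th -kE; ring.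
  rewrite sinDpi cosDpi.
  have C1 : 1 <= C r by apply: coth_ge1; lra.
  have sk : 0 <= sin k by rewrite sin_ge0_pi// (ltW k0).
  have kc : k * cos k <= sin k by apply: k_cos_le_sin; rewrite (ltW k0).
  by nra.
- rewrite /z; have -> : th (r - 1) = pi by rewrite /th -kE; ring.
  by rewrite sinpi cospi mulr0; lra.
- move=> t tr zt; rewrite /z'' -mulrDl mulr_gt0//.
  have t0 := tn _ tr; have s0 := sinh_gt0 t0; have /andP[t1 t2] := tr.
  have S0 : 0 < sinh t by apply: sinh_gt0; lra.
  suff : potential (n := n) t < 2 / sinh (t - n%:R) ^+ 2 by lra.
  have := sinh_shift (ler0n R n) (ltW t0); rewrite subrK => H.
  have e1 := expR_ge1Dx (n%:R : R).
  have {}H : (1 + n%:R) * sinh (t - n%:R) <= sinh t by apply: le_trans H; rewrite ler_pM2r.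
  rewrite /potential ltr_pdivrMr ?exprn_gt0// [ltRHS]mulrAC ltr_pdivlMr ?exprn_gt0//.
  have H2 : (1 + n%:R) ^+ 2 * sinh (t - n%:R) ^+ 2 <= sinh t ^+ 2.
    have P : 0 <= (1 + n%:R) * sinh (t - n%:R) by apply: mulr_ge0; [lra | exact: ltW].
    by rewrite -exprMn lerXn2r// nnegrE ltW.
  have : nu * sinh (t - n%:R) ^+ 2 < 2 * ((1 + n%:R) ^+ 2 * sinh (t - n%:R) ^+ 2).
    rewrite mulrA ltr_pM2r ?exprn_gt0// /liouville_exp; nra.
  by lra.
by exists t => //; apply/andP; split; lra.
Qed.

Local Notation alpha := ((n%:R - 1) / 2 : R).

(** With l = ln((1+s)/(1-s)) = ln cosh rho, the function exp(-alpha l) sin(k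
    (l + 2n)) satisfies Delta f = -(alpha^2 + k^2) f - exp(-alpha l)
    cosh^-2(rho) ((alpha (alpha+1) - k^2) sin - n k cos), and the last bracket
    is nonnegative since th cos th <= sin th for th = k (l + 2n) >= 2 n k.
    Positivity on the ball only needs k (r + 2n) <= pi, as ln cosh rho < rho.
    *)
Lemma barta_bound_long r : 2 * (n%:R + 2) <= r ->
  barta_bound (n := n) (tanh_half r ^+ 2) (alpha ^+ 2 + (pi / (r + 2 * n%:R)) ^+ 2).
Proof.
move=> rn; have nn := n_ge2; have pi0 := pi_gt0 R.
have r0 : 0 < r by lra.
have T0 := tanh_half_gt0 r0; have T1 := tanh_half_lt1 r.
set k := pi / (r + 2 * n%:R).
have k0 : 0 < k by rewrite divr_gt0//; lra.
have kE : k * (r + 2 * n%:R) = pi by rewrite /k divfK// gt_eqF//; lra.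
have k12 : k <= 1 / 2.
  by rewrite /k ler_pdivrMr; [have := pihalf_lt2 R; lra | lra].
pose e (s : R) := expR (- alpha * two_artanh s).
pose th (s : R) := k * two_artanh s + k * (2 * n%:R).
pose f (s : R) := e s * sin (th s).
pose f' (s : R) := e s * (- alpha * sin (th s) + k * cos (th s)) * (2 / (1 - s ^+ 2)).
pose f'' (s : R) := e s * ((alpha ^+ 2 - k ^+ 2) * sin (th s)
    - 2 * alpha * k * cos (th s)) * (2 / (1 - s ^+ 2)) ^+ 2
  + e s * (- alpha * sin (th s) + k * cos (th s)) * (4 * s / (1 - s ^+ 2) ^+ 2).
have s2 (s : R) : -1 < s < 1 -> 1 - s ^+ 2 != 0.
  by move=> /andP[s1 s3]; rewrite gt_eqF//; nra.
have de (s : R) : -1 < s < 1 -> is_derive s 1 e (- alpha * e s * (2 / (1 - s ^+ 2))).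
  by move=> s1; have dA := is_derive_two_artanh s1; rewrite /e; differentiate; ring.
have dth (s : R) : -1 < s < 1 -> is_derive s 1 th (k * (2 / (1 - s ^+ 2))).
  by move=> s1; have dA := is_derive_two_artanh s1; rewrite /th; differentiate; ring.
have thpi (s : R) : 0 <= s <= tanh_half r ^+ 2 ->
    [/\ 0 <= two_artanh s, 0 < th s & th s < pi].
  move=> /andP[s0 sS]; have sT : s < tanh_half r by nra.
  have a0 : 0 <= two_artanh s.
    rewrite /two_artanh subr_ge0; apply: (@le_trans _ _ 0); first by apply: ln_le0; lra.
    by apply: ln_ge0; lra.
  have ar : two_artanh s < r by rewrite two_artanh_lt//; apply/andP; split; lra.
  by split=> //; rewrite /th; [|rewrite -kE]; nra.
apply: (@barta_bound_radial R n _ _ f f' f''); first by nra.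
- move=> s s1; have d1 := de s s1; have d2 := dth s s1.
  by rewrite /f; differentiate; rewrite /f'; ring.
- move=> s s1; have d1 := de s s1; have d2 := dth s s1; have s0 := s2 s s1.
  by rewrite /f'; differentiate => //; rewrite /f'' /=; field.
- move=> s /thpi[_ t0 t1]; rewrite /f mulr_gt0 ?expR_gt0// sin_gt0_pi//.
  by rewrite t0.
- move=> s sS; have [a0 t0 t1] := thpi s sS; have /andP[s0 sT] := sS.
  have s1 : s < 1 by nra.
  set x := sin (th s); set c := cos (th s).
  have x0 : 0 <= x by rewrite sin_ge0_pi// (ltW t0) (ltW t1).
  have tc : th s * c <= x by apply: k_cos_le_sin; rewrite (ltW t0) (ltW t1).
  have br : 0 <= (alpha * (alpha + 1) - k ^+ 2) * x - n%:R * k * c.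
    have al : 1 / 2 <= alpha * (alpha + 1) - k ^+ 2 by nra.
    have [c0|c0] := lerP c 0.
      have : 0 <= n%:R * k by rewrite mulr_ge0// ltW.
      nra.
    have kac : 0 <= k * two_artanh s * c.
      by apply: mulr_ge0; [apply: mulr_ge0 => //; exact: ltW | exact: ltW].
    have H1 : n%:R * k * c <= th s * c / 2.
      have -> : th s * c / 2 = n%:R * k * c + k * two_artanh s * c / 2.
        by rewrite /th; field.
      by lra.
    nra.
  rewrite -subr_ge0.
  have -> : - (alpha ^+ 2 + k ^+ 2) * f s - ((1 - s) ^+ 2 * (s * f'' s + n%:R / 2 * f' s)
     + (n%:R - 2) * (1 - s) * s * f' s) =
     e s * ((1 - s) / (1 + s)) ^+ 2 * ((alpha * (alpha + 1) - k ^+ 2) * x - n%:R * k * c).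
    have sp : 1 + s != 0 by rewrite gt_eqF//; lra.
    have sm : 1 - s != 0 by rewrite gt_eqF//; lra.
    rewrite /f'' /f' /f -/x -/c; have -> : 1 - s ^+ 2 = (1 - s) * (1 + s) by ring.
    by field; rewrite sp sm.
  by rewrite mulr_ge0// mulr_ge0 ?expR_ge0 ?sqr_ge0.
Qed.
End SpectralBounds.

(** * The gap *)

Section Gap.
Context {R : realType} {n : nat}.
Hypothesis n2 : (2 <= n)%N.
Implicit Types (r t : R).

Let n_ge2 : 2 <= n%:R :> R.
Proof. by rewrite ler_nat. Qed.

(** A nonpositive value of the solution for mu1 inside the ball turns into a
    zero on its boundary for some mu <= mu1, and the eigenvalue for n is mu -
    n. *)
Lemma hyp_eigenvalue_bounds r t k2 : 0 < t <= r -> 0 <= k2 ->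
  regular (n := n) (@liouville_exp R n ^+ 2 + k2) (tanh_half t ^+ 2) <= 0 ->
  [/\ forall m, barta_bound (n := n) (tanh_half r ^+ 2) m -> m <= hyp_eigenvalue n 1 r,
      hyp_eigenvalue n 1 r <= hyp_eigenvalue n 2 r &
      hyp_eigenvalue n 2 r <= ((n%:R - 1) / 2) ^+ 2 + k2].
Proof.
move=> /andP[t0 tr] k20 ht; have r0 : 0 < r by exact: lt_le_trans tr.
have T0 := tanh_half_gt0 r0; have T1 := tanh_half_lt1 r; have t1 := tanh_half_gt0 t0.
have Ttr := tanh_half_le tr.
have mu0 : 0 <= @liouville_exp R n ^+ 2 + k2 by rewrite addr_ge0// sqr_ge0.
have [||mu /andP[_ mule] hS] := @regular_zero_exists R n _ (tanh_half r ^+ 2) mu0.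
- by apply/andP; split; nra.
- by exists (tanh_half t ^+ 2) => //; apply/andP; split; nra.
have S01 : 0 < tanh_half r ^+ 2 < 1 by apply/andP; split; nra.
have [H1 H2 H3] := eigenvalue_bounds n2 S01 hS.
rewrite /hyp_eigenvalue hyp_ballE//; split=> //.
apply: le_trans H3 _; rewrite lerBlDr; apply: le_trans mule _.
by rewrite /liouville_exp; lra.
Qed.

(** Valid for all r; for bounded r this O(r^-2) bound is already O(r^-3). *)
Lemma gap_short r : 0 < r ->
  0 <= hyp_eigenvalue n 2 r - hyp_eigenvalue n 1 r <=
  ((n%:R - 1) / 2) ^+ 2 + (4 * pi ^+ 2 + n%:R ^+ 2) / r ^+ 2.
Proof.
move=> r0; have nn := n_ge2.
have [t tr] := regular_nonpos_short n2 r0.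
set k2 := _ / r ^+ 2 => ht.
have pp : 0 <= pi ^+ 2 :> R by exact: sqr_ge0.
have k2E : k2 = (4 * pi ^+ 2 + n%:R ^+ 2) / r ^+ 2.
  by rewrite /k2 /liouville_exp; congr (_ / _); field.
have k20 : 0 <= k2 by rewrite k2E divr_ge0 ?sqr_ge0// addr_ge0 ?sqr_ge0// mulr_ge0.
have [H1 H2 H3] := hyp_eigenvalue_bounds tr k20 ht.
have b0 : 0 <= hyp_eigenvalue n 1 r.
  apply: H1; apply: barta_bound0.
  by have := tanh_half_gt0 r0; have := tanh_half_lt1 r; nra.
by apply/andP; split; rewrite -?k2E; lra.
Qed.

Lemma inv_sqr_sub_le (x y r : R) : 0 < r -> r / 2 <= x -> r <= y -> x <= y ->
  (pi / x) ^+ 2 - (pi / y) ^+ 2 <= 8 * pi ^+ 2 * (y - x) / r ^+ 3.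
Proof.
move=> r0 rx ry xy; have x0 : 0 < x by lra.
have y0 : 0 < y by lra.
have p0 : 0 <= pi ^+ 2 :> R by exact: sqr_ge0.
have -> : (pi / x) ^+ 2 - (pi / y) ^+ 2 =
    pi ^+ 2 * ((y - x) * ((y + x) / (x ^+ 2 * y ^+ 2))).
  by field; rewrite !gt_eqF.
have -> : 8 * pi ^+ 2 * (y - x) / r ^+ 3 = pi ^+ 2 * ((y - x) * (8 / r ^+ 3)).
  by ring.
apply: ler_wpM2l => //; apply: ler_wpM2l; first by rewrite subr_ge0.
apply: (@le_trans _ _ (2 / (x ^+ 2 * y))).
  have -> : 2 / (x ^+ 2 * y) = (2 * y) / (x ^+ 2 * y ^+ 2).
    by field; rewrite !gt_eqF.
  by rewrite ler_pM2r ?invr_gt0 ?mulr_gt0 ?exprn_gt0//; lra.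
rewrite ler_pdivrMr ?mulr_gt0 ?exprn_gt0// mulrAC ler_pdivlMr ?exprn_gt0//.
have h1 : r ^+ 2 <= 4 * x ^+ 2 by nra.
have -> : r ^+ 3 = r ^+ 2 * r by rewrite -exprSr.
have h2 : r ^+ 2 * r <= 4 * x ^+ 2 * y.
  by apply: ler_pM => //; [exact: sqr_ge0 | exact: ltW].
lra.
Qed.

Lemma gap_long r : 2 * (n%:R + 2) <= r ->
  hyp_eigenvalue n 2 r - hyp_eigenvalue n 1 r <=
  8 * pi ^+ 2 * (3 * n%:R + 2) / r ^+ 3.
Proof.
move=> rn; have nn := n_ge2; have r0 : 0 < r by lra.
have [t tr ht] := regular_nonpos_long n2 rn.
have [H1 H2 H3] := hyp_eigenvalue_bounds tr (sqr_ge0 _) ht.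
have := H1 _ (barta_bound_long n2 rn).
have := @inv_sqr_sub_le (r - n%:R - 2) (r + 2 * n%:R) r r0.
have -> : r + 2 * n%:R - (r - n%:R - 2) = 3 * n%:R + 2 by ring.
by move=> /(_ _ _ _)H; have := H ltac:(lra) ltac:(lra) ltac:(lra); lra.
Qed.

Lemma gap_le : exists2 C : R, 0 <= C & forall r, 0 < r ->
  0 <= hyp_eigenvalue n 2 r - hyp_eigenvalue n 1 r <= C / r ^+ 3.
Proof.
have nn := n_ge2.
have p0 : 0 <= pi ^+ 2 :> R by exact: sqr_ge0.
pose r1 : R := 2 * (n%:R + 2).
pose C1 : R := 8 * pi ^+ 2 * (3 * n%:R + 2).
pose A : R := ((n%:R - 1) / 2) ^+ 2; pose K : R := 4 * pi ^+ 2 + n%:R ^+ 2.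
have A0 : 0 <= A by exact: sqr_ge0.
have K0 : 0 <= K by rewrite addr_ge0 ?sqr_ge0// mulr_ge0.
have C10 : 0 <= C1 by apply: mulr_ge0; [exact: mulr_ge0 | lra].
have r10 : 0 <= r1 by rewrite /r1; lra.
have r13 : 0 <= r1 ^+ 3 by rewrite exprn_ge0.
(* the long-range constant plus (A + K/r^2) r^3 evaluated at r = r1 *)
exists (C1 + (A * r1 ^+ 3 + K * r1)).
  by rewrite addr_ge0// addr_ge0// mulr_ge0.
move=> r r0; have /andP[g0 g1] := gap_short r0; rewrite g0 /=.
have r30 : 0 < r ^+ 3 by rewrite exprn_gt0.
have [rl|rs] := leP r1 r.
  apply: le_trans (gap_long rl) _; rewrite ler_pM2r ?invr_gt0// lerDl.
  by rewrite addr_ge0// mulr_ge0.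
apply: le_trans g1 _; rewrite -/A -/K ler_pdivlMr//.
have -> : (A + K / r ^+ 2) * r ^+ 3 = A * r ^+ 3 + K * r by field; rewrite gt_eqF.
have h1 : A * r ^+ 3 <= A * r1 ^+ 3.
  by apply: ler_wpM2l => //; rewrite lerXn2r ?nnegrE// ltW.
have h2 : K * r <= K * r1 by apply: ler_wpM2l => //; exact: ltW.
lra.
Qed.
End Gap.

Theorem theorem1p2 (R : realType) (n : nat) (hn : (2 <= n)%N) :
  (exists C : R, forall r : R, 0 < r ->
     hyp_eigenvalue n 2 r - hyp_eigenvalue n 1 r <= C / r ^+ 3) /\
  ((hyp_eigenvalue n 2 r - hyp_eigenvalue n 1 r) * r ^+ 2
     @[r --> +oo] --> (0 : R)).
Proof.
have [C C0 gap] := @gap_le R n hn.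
split; first by exists C => r /gap /andP[].
apply/cvgrPdist_le => e e0; near=> r.
have r0 : 0 < r by near: r; apply: nbhs_pinfty_gt; exact: num_real.
have rC : C / e < r by near: r; apply: nbhs_pinfty_gt; exact: num_real.
have /andP[g0 g1] := gap r r0.
rewrite sub0r normrN ger0_norm ?mulr_ge0 ?sqr_ge0//.
apply: (@le_trans _ _ (C / r ^+ 3 * r ^+ 2)).
  by rewrite ler_pM2r ?exprn_gt0.
have -> : C / r ^+ 3 * r ^+ 2 = C / r by field; rewrite gt_eqF.
by rewrite ler_pdivrMr// mulrC -ler_pdivrMr// ltW.
Unshelve. all: by end_near. Qed.
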